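(* Let $\mu\ge 0$ be a Radon measure on $\mathbb{R}^n$. Then $T_\mu\le V_\mu$, i.e. the tangent distribution $T_\mu$ and the Alberti--Marchese distribution $V_\mu$ satisfy $T_\mu(x)\subseteq V_\mu(x)$ for $\mu$-a.e. $x\in\mathbb{R}^n$.
   Context: Test plans. $d_{\rm Eucl}(x,y)=|x-y|$; $C([0,1],\mathbb{R}^n)$ has the supremum distance; $e_t(\gamma)=\gamma_t$; $AC^2([0,1],\mathbb{R}^n)$ is the set of absolutely continuous curves $\gamma$ with $\int_0^1|\dot\gamma_t|^2\,dt<\infty$. A test plan on $(\mathbb{R}^n,d_{\rm Eucl},\mu)$ is a Borel probability measure $\pi$ on $C([0,1],\mathbb{R}^n)$, concentrated on $AC^2([0,1],\mathbb{R}^n)$, with $\int\int_0^1|\dot\gamma_t|^2\,dt\,d\pi(\gamma)<\infty$ and $(e_t)_*\pi\le C\mu$ for all $t\in[0,1]$, for some constant $C>0$. Sobolev space. A nonnegative $G\in L^2(\mu)$ is a weak upper gradient of $f\in L^2(\mu)$ if for every test plan $\pi$, for $\pi$-a.e. $\gamma$ one has $f\circ\gamma\in W^{1,1}(0,1)$ and $|(f\circ\gamma)'_t|\le G(\gamma_t)|\dot\gamma_t|$ for a.e. $t$. $W^{1,2}(\mathbb{R}^n,\mu)$ is the set of $f\in L^2(\mu)$ having a weak upper gradient; $|D_\mu f|$ is the $\mu$-a.e. minimal one. The norm is $(\|f\|_{L^2(\mu)}^2+\||D_\mu f|\|_{L^2(\mu)}^2)^{1/2}$; it is known that this space is Hilbert.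 Normed modules. An $L^2(\mu)$-normed $L^\infty(\mu)$-module is an $L^\infty(\mu)$-module $\mathscr M$ with a map $|\cdot|:\mathscr M\to L^2(\mu)$ such that, $\mu$-a.e., $|v|\ge0$ with equality iff $v=0$, $|v+w|\le|v|+|w|$, $|fv|=|f||v|$, and such that the norm $\||v|\|_{L^2(\mu)}$ is complete. Morphisms are $L^\infty(\mu)$-linear continuous maps. The dual $\mathscr M^*$ is the module of $L^\infty(\mu)$-linear continuous maps $L:\mathscr M\to L^1(\mu)$, with $|L|$ the minimal $G\in L^2(\mu)$ such that $|L(v)|\le G|v|$ $\mu$-a.e. for all $v$. $L^2(\mathbb{R}^n,\mathbb{R}^n;\mu)$ and its dual $L^2(\mathbb{R}^n,(\mathbb{R}^n)^*;\mu)$ are such modules with the Euclidean pointwise norms. Tangent module and $\iota_\mu$. The cotangent module is the unique (up to isomorphism) couple $(L^2_\mu(T^*\mathbb{R}^n),d_\mu)$ of an $L^2(\mu)$-normed $L^\infty(\mu)$-module and a linear map $d_\mu:W^{1,2}(\mathbb{R}^n,\mu)\to L^2_\mu(T^*\mathbb{R}^n)$ such that $|d_\mu f|=|D_\mu f|$ $\mu$-a.e. and finite $L^\infty(\mu)$-combinations of the $d_\mu f$ are dense. The tangent module is $L^2_\mu(T\mathbb{R}^n):=L^2_\mu(T^*\mathbb{R}^n)^*$. It is known that there is a unique morphism ${\rm P}_\mu:L^2(\mathbb{R}^n,(\mathbb{R}^n)^*;\mu)\to L^2_\mu(T^*\mathbb{R}^n)$ with ${\rm P}_\mu(df)=d_\mu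 f$ for all $f\in C_c^\infty(\mathbb{R}^n)$, and that its adjoint $\iota_\mu:L^2_\mu(T\mathbb{R}^n)\to L^2(\mathbb{R}^n,\mathbb{R}^n;\mu)$, i.e. the morphism with ${\rm P}_\mu(\underline\omega)(v)=\underline\omega(\iota_\mu(v))$ for all $v,\underline\omega$, satisfies $|\iota_\mu(v)|=|v|$ $\mu$-a.e. Distributions. ${\rm Gr}(\mathbb{R}^n)$ is the set of linear subspaces of $\mathbb{R}^n$ with the metric given by the Hausdorff distance between closed unit balls. $\mathscr D_n(\mu)$ is the set of Borel maps $V:\mathbb{R}^n\to{\rm Gr}(\mathbb{R}^n)$ up to $\mu$-a.e. equality (called distributions). $\Gamma(V):=\{\underline v\in L^2(\mathbb{R}^n,\mathbb{R}^n;\mu):\underline v(x)\in V(x)\text{ for }\mu\text{-a.e. }x\}$. The map $\Gamma$ is a bijection between $\mathscr D_n(\mu)$ and the (closed) $L^2(\mu)$-normed $L^\infty(\mu)$-submodules of $L^2(\mathbb{R}^n,\mathbb{R}^n;\mu)$. The tangent distribution $T_\mu$ is the unique element of $\mathscr D_n(\mu)$ with $\Gamma(T_\mu)=\iota_\mu(L^2_\mu(T\mathbb{R}^n))$. Alberti--Marchese distribution. By a theorem of Alberti and Marchese there is a unique $V_\mu\in\mathscr D_n(\mu)$ such that: (1) for every compactly supported Lipschitz $f:\mathbb{R}^n\to\mathbb{R}$ there is a vector field $\nabla_{\rm AM}f\in\Gamma(V_\mu)$ with $\lim_{V_\mu(x)\ni v\to0}\frac{f(x+v)-f(x)-\nabla_{\rm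 AM}f(x)\cdot v}{|v|}=0$ for $\mu$-a.e. $x$; (2) there is a Lipschitz function $f_0:\mathbb{R}^n\to\mathbb{R}$ such that for $\mu$-a.e. $x$, $f_0$ is not differentiable at $x$ in any direction $v\in\mathbb{R}^n\setminus V_\mu(x)$. *)

(* Defs.v *)
From HB Require Import structures.
From mathcomp Require Import all_boot all_order all_algebra.
From mathcomp Require Import all_classical all_reals all_analysis.

Set Implicit Arguments.
Unset Strict Implicit.
Unset Printing Implicit Defensive.

Import Order.TTheory GRing.Theory Num.Theory.
Import numFieldNormedType.Exports.

Local Open Scope classical_set_scope.
Local Open Scope ring_scope.

(** ** Euclidean space

   R^n is ['rV[R]_n] and its dual (R^n)^* is ['cV[R]_n], a covector [w] acting on
   a vector [v] by [v *m w].  The library norm of a matrix is the sup norm: it is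
   used here only through the topology that it induces. *)

HB.instance Definition _ (R : realType) (p q : nat) :=
  Measurable.copy 'M[R]_(p, q) (g_sigma_algebraType (@open 'M[R]_(p, q))).

Definition enorm {R : realType} {p q : nat} (A : 'M[R]_(p, q)) : R :=
  Num.sqrt (\sum_i \sum_j A i j ^+ 2).

Section euclidean.
Context {R : realType} {n : nat}.
Implicit Types (f : 'rV[R]_n -> R).

Definition pairing (v : 'rV[R]_n) (w : 'cV[R]_n) : R := (v *m w) 0 0.

Definition dotv (v w : 'rV[R]_n) : R := pairing v w^T.

Definition elipschitz f : Prop :=
  exists L : R, forall x y, `|f x - f y| <= L * enorm (x - y).

Definition compactly_supported f : Prop := compact (closure [set x | f x != 0]).

(* All iterated directional derivatives exist and are differentiable. *)
Definition smooth f : Prop :=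
  forall (s : seq 'rV[R]_n) (x : 'rV[R]_n),
    differentiable (foldr (fun v g => 'D_v g) f s) x.

Definition Cc_infty f : Prop := smooth f /\ compactly_supported f.

Definition differential f (x : 'rV[R]_n) : 'cV[R]_n :=
  \col_i 'D_(delta_mx 0 i) f x.

(* On R^n the regularity of a locally finite Borel measure is automatic. *)
Definition radon (mu : {measure set 'rV[R]_n -> \bar R}) : Prop :=
  forall K : set 'rV[R]_n, compact K -> (mu K < +oo)%E.

End euclidean.

(** ** Curves

   An element of C([0,1], R^n) is represented by its extension to R which is
   constant on ]-oo, 0] and on [1, +oo[, so that two curves are equal as soon as
   they agree on [0,1]. *)

Section curves.
Context {R : realType} {n : nat}.

Record curve := Curve {
  curve_fun :> R -> 'rV[R]_n ;
  curve_cont : {within `[0, 1], continuous curve_fun} ;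
  curve_clamp : forall t, curve_fun t = curve_fun (Num.max 0 (Num.min t 1)) }.

Lemma curve0_cont : {within `[0, 1], continuous (cst 0 : R -> 'rV[R]_n)}.
Proof. by move=> x; exact: cvg_cst. Qed.

Definition curve0 : curve := Curve curve0_cont (fun=> erefl).

Definition curve_dist (g h : curve) : R :=
  sup [set enorm (g t - h t) | t in `[0, 1]].

Definition curve_open (O : set curve) : Prop :=
  forall g, O g -> exists2 r : R, 0 < r & forall h, curve_dist g h < r -> O h.

Definition abs_continuous (g : R -> 'rV[R]_n) : Prop :=
  forall e : R, 0 < e -> exists2 d : R, 0 < d &
    forall (k : nat) (a b : 'I_k -> R),
      (forall i, 0 <= a i <= b i /\ b i <= 1) ->
      (forall i j, i != j -> `]a i, b i[ `&` `]a j, b j[ = set0) ->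
      \sum_i (b i - a i) < d -> \sum_i enorm (g (b i) - g (a i)) < e.

Definition speed (g : R -> 'rV[R]_n) (t : R) : R := enorm (derive1 g t).

Definition energy (g : R -> 'rV[R]_n) : \bar R :=
  (\int[lebesgue_measure]_(t in `[0%R, 1%R]) (speed g t ^+ 2)%:E)%E.

Definition AC2 (g : R -> 'rV[R]_n) : Prop :=
  abs_continuous g /\ (energy g < +oo)%E.

End curves.
Arguments curve : clear implicits.

HB.instance Definition _ (R : realType) (n : nat) := gen_eqMixin (curve R n).
HB.instance Definition _ (R : realType) (n : nat) := gen_choiceMixin (curve R n).
HB.instance Definition _ (R : realType) (n : nat) :=
  isPointed.Build (curve R n) curve0.
HB.instance Definition _ (R : realType) (n : nat) :=
  Measurable.copy (curve R n) (g_sigma_algebraType (@curve_open R n)).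

(** ** Sobolev functions

   Elements of L^p(mu) are represented by functions in [Lfun mu p], identified
   when they agree mu-almost everywhere. *)

Section sobolev.
Context {R : realType}.

Definition test_function (phi : R -> R) : Prop :=
  (forall (k : nat) (t : R), derivable (derive1n k phi) t 1) /\
  exists a b : R, [/\ 0 < a, b < 1 & forall t, t \notin `[a, b] -> phi t = 0].

(* [h] is in W^{1,1}(0,1), with distributional derivative [h']. *)
Definition W11_derivative (h h' : R -> R) : Prop :=
  [/\ lebesgue_measure.-integrable `]0, 1[ (EFin \o h),
      lebesgue_measure.-integrable `]0, 1[ (EFin \o h') &
      forall phi, test_function phi ->
        \int[lebesgue_measure]_(t in `]0, 1[) (h t * derive1 phi t) =
        - \int[lebesgue_measure]_(t in `]0, 1[) (h' t * phi t)].

Context {n : nat} (mu : {measure set 'rV[R]_n -> \bar R}).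
Implicit Types (f G : 'rV[R]_n -> R).

Definition test_plan (pi : probability (curve R n) R) : Prop :=
  [/\ {ae pi, forall g : curve R n, AC2 g},
      (\int[pi]_g energy g < +oo)%E &
      exists2 C : R, 0 < C &
        forall t : R, t \in `[0, 1] -> forall A : set 'rV[R]_n, measurable A ->
          (pi [set g : curve R n | A (g t)] <= C%:E * mu A)%E].

Definition weak_upper_gradient f G : Prop :=
  [/\ G \in Lfun mu 2%:E,
      {ae mu, forall x, 0 <= G x} &
      forall pi, test_plan pi ->
        {ae pi, forall g : curve R n, exists2 h' : R -> R,
           W11_derivative (f \o g) h' &
           {ae lebesgue_measure, forall t : R, t \in `]0, 1[ ->
              `|h' t| <= G (g t) * speed g t}}].

Definition W12 f : Prop :=
  f \in Lfun mu 2%:E /\ exists G, weak_upper_gradient f G.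

Definition minimal_weak_upper_gradient f G : Prop :=
  weak_upper_gradient f G /\
  forall H, weak_upper_gradient f H -> {ae mu, forall x, G x <= H x}.

End sobolev.

(** ** L^2(mu)-normed L^oo(mu)-modules

   A [premodule] is the data of a module presented by representatives: [nm_elt] is
   the set of those elements of [nm_car] that represent an element of the module,
   [nm_eq] says when two of them represent the same one, [nm_act] is the
   multiplication by (representatives of) elements of L^oo(mu), and [nm_norm v]
   represents the pointwise norm of [v]. *)

Section normed_modules.
Context {R : realType} d (T : measurableType d) (mu : {measure set T -> \bar R}).

Record premodule := PreModule {
  nm_car :> zmodType ;
  nm_elt : set nm_car ;
  nm_eq : nm_car -> nm_car -> Prop ;
  nm_act : (T -> R) -> nm_car -> nm_car ;
  nm_norm : nm_car -> T -> R }.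

Definition nm_dist (M : premodule) (v w : M) : \bar R :=
  'N[mu]_2%:E [EFin \o nm_norm (v - w)%R].

Record is_normed_module (M : premodule) : Prop := IsNormedModule {
  nm_elt0 : nm_elt (0 : M) ;
  nm_eltB : forall v w : M, nm_elt v -> nm_elt w -> nm_elt (v - w) ;
  nm_elt_act : forall f (v : M),
    f \in Lfun mu +oo%E -> nm_elt v -> nm_elt (nm_act f v) ;
  nm_eq_refl : forall v : M, nm_elt v -> nm_eq v v ;
  nm_eq_sym : forall v w : M,
    nm_elt v -> nm_elt w -> nm_eq v w -> nm_eq w v ;
  nm_eq_trans : forall u v w : M, nm_elt u -> nm_elt v -> nm_elt w ->
    nm_eq u v -> nm_eq v w -> nm_eq u w ;
  nm_eqB : forall v v' w w' : M,
    nm_elt v -> nm_elt v' -> nm_elt w -> nm_elt w' ->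
    nm_eq v v' -> nm_eq w w' -> nm_eq (v - w) (v' - w') ;
  nm_eq_act : forall f g (v w : M),
    f \in Lfun mu +oo%E -> g \in Lfun mu +oo%E -> nm_elt v -> nm_elt w ->
    f = g %[ae mu] -> nm_eq v w -> nm_eq (nm_act f v) (nm_act g w) ;
  nm_act1 : forall v : M, nm_elt v -> nm_eq (nm_act (cst 1) v) v ;
  nm_actM : forall f g (v : M),
    f \in Lfun mu +oo%E -> g \in Lfun mu +oo%E -> nm_elt v ->
    nm_eq (nm_act (f \* g) v) (nm_act f (nm_act g v)) ;
  nm_actDl : forall f g (v : M),
    f \in Lfun mu +oo%E -> g \in Lfun mu +oo%E -> nm_elt v ->
    nm_eq (nm_act (f \+ g) v) (nm_act f v + nm_act g v) ;
  nm_actDr : forall f (v w : M),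
    f \in Lfun mu +oo%E -> nm_elt v -> nm_elt w ->
    nm_eq (nm_act f (v + w)) (nm_act f v + nm_act f w) ;
  nm_norm_L2 : forall v : M, nm_elt v -> nm_norm v \in Lfun mu 2%:E ;
  nm_norm_eq : forall v w : M, nm_elt v -> nm_elt w ->
    nm_eq v w -> nm_norm v = nm_norm w %[ae mu] ;
  nm_norm_ge0 : forall v : M, nm_elt v -> {ae mu, forall x, 0 <= nm_norm v x} ;
  nm_norm_eq0 : forall v : M, nm_elt v ->
    (nm_norm v = cst 0 %[ae mu] <-> nm_eq v 0) ;
  nm_normD : forall v w : M, nm_elt v -> nm_elt w ->
    {ae mu, forall x, nm_norm (v + w) x <= nm_norm v x + nm_norm w x} ;
  nm_norm_act : forall f (v : M), f \in Lfun mu +oo%E -> nm_elt v ->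
    nm_norm (nm_act f v) = (fun x => `|f x| * nm_norm v x) %[ae mu] ;
  nm_complete : forall u : nat -> M, (forall k, nm_elt (u k)) ->
    (forall e : R, 0 < e -> exists N, forall k l, (N <= k)%N -> (N <= l)%N ->
      (nm_dist (u k) (u l) < e%:E)%E) ->
    exists2 v : M, nm_elt v &
      forall e : R, 0 < e -> exists N, forall k, (N <= k)%N ->
        (nm_dist (u k) v < e%:E)%E }.

Definition nm_morphism (M N : premodule) (F : M -> N) : Prop :=
  [/\ forall v, nm_elt v -> nm_elt (F v),
      forall v w, nm_elt v -> nm_elt w -> nm_eq v w -> nm_eq (F v) (F w),
      forall f v w, f \in Lfun mu +oo%E -> nm_elt v -> nm_elt w ->
        nm_eq (F (nm_act f v + w)) (nm_act f (F v) + F w) &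
      forall v, nm_elt v -> forall e : R, 0 < e -> exists2 r : R, 0 < r &
        forall w, nm_elt w ->
          (nm_dist w v < r%:E)%E -> (nm_dist (F w) (F v) < e%:E)%E].

Section dual.
Variable M : premodule.
Implicit Type L : M -> T -> R.

Definition dual_elt L : Prop :=
  [/\ forall v, nm_elt v -> L v \in Lfun mu 1%E,
      forall v w, nm_elt v -> nm_elt w -> nm_eq v w -> L v = L w %[ae mu],
      forall f v w, f \in Lfun mu +oo%E -> nm_elt v -> nm_elt w ->
        L (nm_act f v + w) = f \* L v \+ L w %[ae mu] &
      forall v, nm_elt v -> forall e : R, 0 < e -> exists2 r : R, 0 < r &
        forall w, nm_elt w -> (nm_dist w v < r%:E)%E ->
          ('N[mu]_1%E [EFin \o (L w \- L v)%R] < e%:E)%E].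

Definition dual_bound L (G : T -> R) : Prop :=
  [/\ G \in Lfun mu 2%:E,
      {ae mu, forall x, 0 <= G x} &
      forall v, nm_elt v -> {ae mu, forall x, `|L v x| <= G x * nm_norm v x}].

Definition dual_norm L : T -> R :=
  xget (cst 0) [set G | dual_bound L G /\
    forall H, dual_bound L H -> {ae mu, forall x, G x <= H x}].

Definition nm_dual : premodule := {|
  nm_car := (M -> T -> R) : zmodType ;
  nm_elt := dual_elt ;
  nm_eq := fun L L' => forall v, nm_elt v -> L v = L' v %[ae mu] ;
  nm_act := fun f L v => f \* L v ;
  nm_norm := dual_norm |}.

End dual.

(* L^2(mu) fields of vectors (p = 1) or of covectors (q = 1). *)
Definition L2fields (p q : nat) : premodule := {|
  nm_car := (T -> 'M[R]_(p, q)) : zmodType ;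
  nm_elt := [set v | measurable_fun setT v /\ enorm \o v \in Lfun mu 2%:E] ;
  nm_eq := fun v w => v = w %[ae mu] ;
  nm_act := fun f v x => f x *: v x ;
  nm_norm := fun v => enorm \o v |}.

End normed_modules.
Arguments premodule {R d} T.

(** ** Cotangent module, its projection P_mu and the embedding iota_mu *)

Section tangent.
Context {R : realType} {n : nat} (mu : {measure set 'rV[R]_n -> \bar R}).

(* The real vector space structure of [M] is the multiplication by constants. *)
Record is_cotangent_module (M : premodule 'rV[R]_n) (d_mu : ('rV[R]_n -> R) -> M)
    : Prop := IsCotangentModule {
  cotangent_normed_module : is_normed_module mu M ;
  cotangent_elt : forall f, W12 mu f -> nm_elt (d_mu f) ;
  cotangent_eq : forall f g, W12 mu f -> W12 mu g ->
    f = g %[ae mu] -> nm_eq (d_mu f) (d_mu g) ;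
  cotangent_linear : forall (c : R) f g, W12 mu f -> W12 mu g ->
    nm_eq (d_mu (fun x => c * f x + g x)) (nm_act (cst c) (d_mu f) + d_mu g) ;
  cotangent_norm : forall f, W12 mu f ->
    minimal_weak_upper_gradient mu f (nm_norm (d_mu f)) ;
  cotangent_dense : forall v : M, nm_elt v -> forall e : R, 0 < e ->
    exists (k : nat) (a f : 'I_k -> 'rV[R]_n -> R),
      [/\ forall i, a i \in Lfun mu +oo%E,
          forall i, W12 mu (f i) &
          (nm_dist mu (\sum_i nm_act (a i) (d_mu (f i))) v < e%:E)%E] }.

Definition is_cotangent_projection (M : premodule 'rV[R]_n)
    (d_mu : ('rV[R]_n -> R) -> M) (P : L2fields mu n 1 -> M) : Prop :=
  nm_morphism mu P /\
  forall f, Cc_infty f -> nm_eq (P (differential f)) (d_mu f).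

Definition is_adjoint (M : premodule 'rV[R]_n) (P : L2fields mu n 1 -> M)
    (iota : nm_dual mu M -> L2fields mu 1 n) : Prop :=
  nm_morphism mu iota /\
  forall (w : L2fields mu n 1) (v : nm_dual mu M), nm_elt w -> nm_elt v ->
    v (P w) = (fun x => pairing (iota v x) (w x)) %[ae mu].

End tangent.

(** ** Distributions *)

Section distributions.
Context {R : realType} {n : nat}.
Implicit Types V W : {vspace 'rV[R]_n}.

Definition edist_to (A : set 'rV[R]_n) (x : 'rV[R]_n) : R :=
  inf [set enorm (x - a) | a in A].

Definition hausdorff_dist (A B : set 'rV[R]_n) : R :=
  Num.max (sup [set edist_to B a | a in A]) (sup [set edist_to A b | b in B]).

Definition unit_ball V : set 'rV[R]_n := [set v | v \in V /\ enorm v <= 1].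

Definition Gr_open (O : set {vspace 'rV[R]_n}) : Prop :=
  forall V, O V -> exists2 r : R, 0 < r &
    forall W, hausdorff_dist (unit_ball V) (unit_ball W) < r -> O W.

Record Gr_distribution := GrDistribution {
  distribution_fun :> 'rV[R]_n -> {vspace 'rV[R]_n} ;
  distribution_borel : forall O, <<s Gr_open >> O ->
    measurable (distribution_fun @^-1` O) }.

Variable mu : {measure set 'rV[R]_n -> \bar R}.

Definition Gamma (V : Gr_distribution) : set (L2fields mu 1 n) :=
  [set v : L2fields mu 1 n | nm_elt v /\
    {ae mu, forall x, (v : 'rV[R]_n -> 'rV[R]_n) x \in V x}].

Definition is_tangent_distribution (M : premodule 'rV[R]_n)
    (iota : nm_dual mu M -> L2fields mu 1 n) (V : Gr_distribution) : Prop :=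
  forall v : L2fields mu 1 n, nm_elt v ->
    (Gamma V v <-> exists2 u : nm_dual mu M, nm_elt u & nm_eq (iota u) v).

Definition is_AM_distribution (V : Gr_distribution) : Prop :=
  (forall f : 'rV[R]_n -> R, elipschitz f -> compactly_supported f ->
     exists2 nabla_f, Gamma V nabla_f &
       {ae mu, forall x,
         (fun v => (f (x + v) - f x - dotv (nabla_f x) v) / enorm v)
           @ within [set v | v \in V x] ((0 : 'rV[R]_n)^') --> (0 : R)}) /\
  (exists2 f0 : 'rV[R]_n -> R, elipschitz f0 &
     {ae mu, forall x, forall v, v \notin V x -> ~ derivable f0 x v}).

End distributions.
Arguments Gr_distribution : clear implicits.

(* Main.v *)
Require Import Defs.
From HB Require Import structures.
From mathcomp Require Import all_boot all_order all_algebra.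
From mathcomp Require Import all_classical all_reals all_analysis.
From mathcomp Require Import measurable_realfun ess_sup_inf ring lra.
Import Order.TTheory GRing.Theory Num.Theory.
Import numFieldNormedType.Exports.
Local Open Scope classical_set_scope.
Local Open Scope ring_scope.
Set Implicit Arguments.
Unset Strict Implicit.
Unset Printing Implicit Defensive.

(** Why the inclusion holds.

    The values of T_mu are spanned by the values of the fields iota_mu(v), so the
    point is that iota_mu(v)(x) lies in V_mu(x) for mu-a.e. x and every v in the
    tangent module ([iota_mem_AM], [tangent_le]).  Dually, P_mu must annihilate
    the covector fields that vanish on V_mu, and this comes from the pointwise
    inequality |d_mu f| <= |nabla_AM f|, that is, from the fact that
    |nabla_AM f| is a weak upper gradient of f ([weak_upper_gradient_AM]).

    The geometric heart is that almost every curve g of a test plan satisfies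
    g'(t) in V_mu(g(t)) for a.e. t.  Let f0 be the Lipschitz function that is
    differentiable in no direction outside V_mu.  The function f0 o g is
    absolutely continuous, hence differentiable at a.e. t, and as f0 is Lipschitz
    it is then differentiable at g(t) in the direction g'(t)
    ([is_derive_along]).  This forces g'(t) into V_mu(g(t)), except where g(t)
    lies in a mu-null set; by Fubini and (e_t)_* pi <= C mu almost every curve
    avoids that set at almost every time ([test_plan_ae_notin]).  Therefore
    (f o g)'(t) = nabla_AM f(g(t)) . g'(t), which is at most |nabla_AM f| |g'|.

    This argument rests on the fundamental theorem of calculus for absolutely
    continuous functions ([abs_cont_ftc]).  Such a function is a difference of
    nondecreasing ones that are again absolutely continuous, because its total
    variation is; their Stieltjes measures are dominated by the Lebesgue measure,
    and the Radon--Nikodym and Lebesgue differentiation theorems conclude.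

    To pass from differentials to arbitrary covector fields, let beta be a smooth
    bump function, positive exactly where |x|^2 < c.  From
    d(x_k beta) - x_k d beta = beta dx_k, every bounded covector field supported
    in this ball becomes, after multiplication by beta, a combination
    sum_j a_j df_j of the differentials of the functions beta and x_k beta, with
    bounded a_j.  For the field e_i - proj_V(e_i), which vanishes on V = V_mu, the
    combination sum_j a_j nabla_AM f_j is zero.  For constant coefficients c_j,
    |sum_j c_j d_mu f_j| = |d_mu (sum_j c_j f_j)| <= |sum_j c_j nabla_AM f_j|, and
    comparing the a_j(x) with rational constants extends the estimate to the
    a_j, so that sum_j a_j d_mu f_j = 0 ([nm_comb_eq0], [coef_eq0]).  Testing
    against v gives beta(x) (e_i - proj_V(e_i)) . iota_mu(v)(x) = 0 for every i,
    hence iota_mu(v)(x) in V(x).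

    Finally, T_mu has enough sections: proj_{T_mu(x)}(e_i) is a Borel function of
    x, because the projection depends continuously on the subspace for the
    Hausdorff distance of unit balls ([oproj_hausdorff_le]). *)

(** * Absolute continuity and total variation *)

Section disjoint_families.
Context {R : realType}.
Implicit Types (F G : R -> R) (p q : R * R) (s t : seq (R * R)).

(** Touching endpoints are allowed, so that the consecutive steps of a partition
    qualify. *)
Definition nonoverlapping p q : bool := (p.2 <= q.1) || (q.2 <= p.1).

Definition unit_subitv p : bool := [&& 0 <= p.1, p.1 <= p.2 & p.2 <= 1].

Definition len s : R := \sum_(p <- s) (p.2 - p.1).

Definition total_incr F s : R := \sum_(p <- s) `|F p.2 - F p.1|.

Definition disjoint_family s := all unit_subitv s && pairwise nonoverlapping s.

(** Absolute continuity on [0,1], with finite families of intervals given as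
    sequences of pairs of endpoints: an interval of the family can then be replaced
    by the steps of a partition of it. *)
Definition abs_cont F : Prop := forall e, 0 < e -> exists2 d, 0 < d &
  forall s, disjoint_family s -> len s < d -> total_incr F s < e.

Lemma nonoverlapping_sym p q : nonoverlapping p q = nonoverlapping q p.
Proof. by rewrite /nonoverlapping orbC. Qed.

Definition steps a (l : seq R) : seq (R * R) := pairmap pair a l.

Lemma steps_in a b l p : itv_partition a b l -> p \in steps a l ->
  [/\ a <= p.1, p.1 <= p.2 & p.2 <= b].
Proof.
case=> + /eqP; elim: l a => [//|x l IH] a /= /andP[ax xl] lb.
have xb : x <= b.
  rewrite -lb; elim: l x {IH ax lb} xl => [//|y l IH] x /= /andP[xy yl].
  exact: le_trans (ltW xy) (IH _ yl).
rewrite inE => /predU1P[->/=|/(IH _ xl lb)[xp1 p12 p2b]]; split => //.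
- exact: ltW.
- exact: le_trans (ltW ax) xp1.
Qed.

Lemma steps_nonoverlapping a b l : itv_partition a b l -> pairwise nonoverlapping (steps a l).
Proof.
case=> + /eqP; elim: l a => [//|x l IH] a /= /andP[ax xl] lb.
rewrite IH// andbT; apply/allP => p pl; apply/orP; left => /=.
by have [|? _ _ //] := @steps_in x b l p _ pl; split=> //; apply/eqP.
Qed.

Lemma steps_len a b l : itv_partition a b l -> len (steps a l) = b - a.
Proof.
case=> + /eqP; rewrite /len; elim: l a => [|x l IH] a /=.
  by move=> _ ->; rewrite big_nil subrr.
by move=> /andP[_ xl] lb; rewrite big_cons IH//=; lra.
Qed.

Lemma variation_steps a b F l : variation a b F l = total_incr F (steps a l).
Proof.
rewrite /variation /total_incr; elim: l a => [|x l IH] a.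
  by rewrite !big_nil.
by rewrite big_nat_recl//= big_cons -[X in _ = _ + X](IH x).
Qed.

Lemma disjoint_family_cons p s : disjoint_family (p :: s) =
  [&& unit_subitv p, all (nonoverlapping p) s & disjoint_family s].
Proof.
rewrite /disjoint_family /=; case: (unit_subitv p) => //=.
by case: (all unit_subitv s); case: (all (nonoverlapping p) s).
Qed.

Lemma disjoint_family_cat s t : disjoint_family (s ++ t) =
  [&& disjoint_family s, disjoint_family t & allrel nonoverlapping s t].
Proof.
rewrite /disjoint_family all_cat pairwise_cat.
by case: (all _ s); case: (all _ t); case: (allrel _ _ _);
  case: (pairwise _ s); case: (pairwise _ t).
Qed.

Lemma len_cons p s : len (p :: s) = p.2 - p.1 + len s.
Proof. exact: big_cons. Qed.

Lemma len_cat s t : len (s ++ t) = len s + len t.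
Proof. exact: big_cat. Qed.

Lemma disjoint_family_steps p l s : disjoint_family (p :: s) ->
  itv_partition p.1 p.2 l -> disjoint_family (steps p.1 l ++ s).
Proof.
rewrite disjoint_family_cons disjoint_family_cat => /and3P[p01 sp ds] pl.
rewrite ds /=; apply/andP; split; first (apply/andP; split).
- apply/allP => q /(steps_in pl)[pq q12 qp].
  case/and3P: p01 => p0 _ p1; apply/and3P; split => //; lra.
- exact: steps_nonoverlapping pl.
- apply/allrelP => q r /(steps_in pl)[pq q12 qp] rs.
  by move/allP : sp => /(_ _ rs); rewrite /nonoverlapping => /orP[|] h; apply/orP;
    [left|right]; lra.
Qed.

(** The bound on increments passes to total variations: the intervals of the family
    are replaced one after the other by the steps of a partition, which changes
    neither the disjointness nor the total length, and then the supremum over the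
    partitions is taken.  The family [t] collects the steps already chosen. *)
Lemma total_variation_total_incr_le (d e : R) F :
  (forall s, disjoint_family s -> len s < d -> total_incr F s <= e) ->
  forall s t, disjoint_family (s ++ t) -> len (s ++ t) < d ->
  (\sum_(p <- s) total_variation p.1 p.2 F + (total_incr F t)%:E <= e%:E)%E.
Proof.
move=> H; elim=> [|p s IH] t.
  by rewrite cat0s big_nil add0e lee_fin => ? ?; exact: H.
rewrite cat_cons => dpst lpst.
have := dpst; rewrite disjoint_family_cons => /and3P[p01 spt dst].
have p12 : p.1 <= p.2 by case/and3P : p01.
have lst : len (s ++ t) < d by move: lpst; rewrite len_cons; lra.
have TV0 : (0 <= \sum_(p <- s) total_variation p.1 p.2 F)%E.
  rewrite big_seq; apply: sume_ge0 => q qs; apply: total_variation_ge0.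
  by move: dst => /andP[+ _] => /allP /(_ q); rewrite mem_cat qs => /(_ isT) /and3P[].
have i0 : 0 <= total_incr F t by apply: sumr_ge0.
have IHt := IH _ dst lst.
have fin : (\sum_(p <- s) total_variation p.1 p.2 F + (total_incr F t)%:E)%E
    \is a fin_num.
  rewrite ge0_fin_numE; first exact: le_lt_trans IHt (ltry _).
  by rewrite adde_ge0 ?lee_fin.
rewrite big_cons -addeA -leeBrDr//.
move: p12; rewrite le_eqVlt => /predU1P[p12|p12].
  by rewrite p12 total_variationxx leeBrDr// add0e.
apply: ge_ereal_sup => _ [_ [l pl <-] <-].
rewrite leeBrDr// variation_steps addeCA -EFinD.
have -> : total_incr F (steps p.1 l) + total_incr F t =
    total_incr F (steps p.1 l ++ t) by rewrite /total_incr big_cat.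
apply: IH.
  have := disjoint_family_steps dpst pl.
  rewrite !disjoint_family_cat => /and3P[dl /and3P[dss dt st]].
  rewrite !allrel_catr => /andP[ls lt]; rewrite dl dss dt st lt /= andbT.
  by rewrite allrelC; under eq_allrel do rewrite nonoverlapping_sym.
by move: lpst; rewrite len_cons !len_cat (steps_len pl); lra.
Qed.

End disjoint_families.

Section absolute_continuity.
Context {R : realType}.
Implicit Types (F G : R -> R) (p q : R * R) (s t : seq (R * R)).

(** Functions on [0,1] are extended to the real line by composition with this
    retraction. *)
Definition clamp (x : R) : R := Num.max 0 (Num.min x 1).

Lemma clamp_ge0 x : 0 <= clamp x. Proof. by rewrite /clamp le_max lexx. Qed.
Lemma clamp_le1 x : clamp x <= 1.
Proof. by rewrite /clamp ge_max ler01 ge_min lexx orbT. Qed.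
Lemma le_clamp x y : x <= y -> clamp x <= clamp y.
Proof.
rewrite /clamp => xy; case: (leP x 1) => x1; case: (leP y 1) => y1;
  rewrite !maxEle; repeat case: ifPn => ?; lra.
Qed.
Lemma clamp_id x : 0 <= x <= 1 -> clamp x = x.
Proof. by case/andP => x0 x1; rewrite /clamp min_l// max_r. Qed.
Lemma clampB_le x y : x <= y -> clamp y - clamp x <= y - x.
Proof.
rewrite /clamp => xy; case: (leP x 1) => x1; case: (leP y 1) => y1;
  rewrite !maxEle; repeat case: ifPn => ?; lra.
Qed.
Lemma dist_clamp_le x y : `|clamp y - clamp x| <= `|y - x|.
Proof.
wlog xy : x y / x <= y.
  move=> h; case: (leP x y) => [|/ltW]; first exact: h.
  by rewrite distrC (distrC y); exact: h.
by rewrite !ger0_norm ?subr_ge0 ?le_clamp ?clampB_le.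
Qed.

Lemma abs_cont_small F e : abs_cont F -> 0 < e -> exists2 d, 0 < d &
  forall x y, 0 <= x -> x <= y -> y <= 1 -> y - x < d -> `|F y - F x| < e.
Proof.
move=> acF e0; have [d d0 H] := acF _ e0; exists d => // x y x0 xy y1 yxd.
have := H [:: (x, y)].
rewrite /disjoint_family /total_incr /len /unit_subitv /= x0 xy y1 !big_seq1/=.
exact.
Qed.

Lemma abs_cont_continuous F : abs_cont F -> continuous (F \o clamp).
Proof.
move=> acF x; apply/cvgrPdist_lt => e e0; have [d d0 H] := abs_cont_small acF e0.
near=> y => /=.
have : `|clamp x - clamp y| < d.
  apply: le_lt_trans (dist_clamp_le _ _) _; near: y.
  exact: (@nbhsx_ballx R R x _ d0).
case: (leP (clamp x) (clamp y)) => xy.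
  rewrite distrC ger0_norm ?subr_ge0// => h; rewrite distrC.
  by apply: H => //; [exact: clamp_ge0|exact: clamp_le1].
rewrite ger0_norm ?subr_ge0 ?ltW// => h.
by apply: H => //; [exact: clamp_ge0|exact: ltW|exact: clamp_le1].
Unshelve. all: by end_near. Qed.

(** The variation is finite on intervals of length less than the modulus [d] of
    absolute continuity, and [0,x] is covered by finitely many of those. *)
Lemma abs_cont_total_variation_lty F x : abs_cont F -> 0 <= x <= 1 ->
  (total_variation 0 x F < +oo)%E.
Proof.
move=> acF; have [d d0 H] := acF _ ltr01.
have small a b : 0 <= a -> a <= b -> b <= 1 -> b - a < d ->
    (total_variation a b F < +oo)%E.
  move=> a0 ab b1 bad; apply: le_lt_trans (ltry 1).
  have := @total_variation_total_incr_le R d 1 F _ [:: (a, b)] [::].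
  rewrite big_seq1 /total_incr big_nil adde0; apply.
  - by move=> s ds ls; exact/ltW/H.
  - by rewrite /disjoint_family /= /unit_subitv /= a0 ab b1.
  - by rewrite /len /= big_seq1.
suff main k : x <= k%:R * (d / 2) -> 0 <= x <= 1 -> (total_variation 0 x F < +oo)%E.
  move=> /andP[x0 x1]; apply: (main (Num.bound (x / (d / 2)))); last by rewrite x0.
  rewrite -ler_pdivrMr ?divr_gt0//; apply/ltW/archi_boundP.
  by rewrite divr_ge0// ltW// divr_gt0.
elim: k x => [|k IH] x.
  rewrite mul0r => xle /andP[x0 _].
  have -> : x = 0 by apply/le_anti; rewrite xle.
  by rewrite total_variationxx.
(* Steps of length d / 2, so that the last one is shorter than d. *)
move=> xk /andP[x0 x1]; pose y := Num.max 0 (x - d / 2).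
have y0 : 0 <= y by rewrite le_max lexx.
have yx : y <= x by rewrite ge_max x0 gerBl ltW// divr_gt0.
rewrite (total_variationD F y0 yx) lte_add_pinfty//.
  apply: IH; last by rewrite y0 (le_trans yx).
  rewrite ge_max mulr_ge0//=; last by rewrite ltW// divr_gt0.
  by move: xk; rewrite -natr1 mulrDl mul1r lerBlDr.
apply: small => //.
have : x - d / 2 <= y by rewrite le_max lexx orbT.
lra.
Qed.

Definition tv F (x : R) : R := fine (total_variation 0 x F).

Lemma tvB F x y : abs_cont F -> 0 <= x -> x <= y -> y <= 1 ->
  (tv F y - tv F x)%:E = total_variation x y F.
Proof.
move=> acF x0 xy y1.
have fx : total_variation 0 x F \is a fin_num.
  rewrite ge0_fin_numE ?total_variation_ge0//; apply: abs_cont_total_variation_lty => //.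
  by rewrite x0 (le_trans xy).
have fy : total_variation 0 y F \is a fin_num.
  rewrite ge0_fin_numE ?total_variation_ge0 ?(le_trans x0)//.
  by apply: abs_cont_total_variation_lty => //; rewrite (le_trans x0).
rewrite EFinB !fineK// (total_variationD F x0 xy).
by rewrite addeC addeA -[X in (X + _)%E]addeC subee// add0e.
Qed.

(** This makes [tv F] and [tv F - F] nondecreasing on [0,1]. *)
Lemma tv_ge F x y : abs_cont F -> 0 <= x -> x <= y -> y <= 1 ->
  `|F y - F x| <= tv F y - tv F x.
Proof.
by move=> acF x0 xy y1; rewrite -lee_fin tvB// total_variation_ge.
Qed.

Lemma abs_cont_tv F : abs_cont F -> abs_cont (tv F).
Proof.
move=> acF e e0; have e20 : 0 < e / 2 by rewrite divr_gt0.
have [d d0 H] := acF _ e20.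
exists d => // s ds ls.
have := @total_variation_total_incr_le R d (e / 2) F _ s [::].
rewrite cats0 /total_incr big_nil adde0 => /(_ _ ds ls) => h.
have {}h := h (fun s ds ls => ltW (H s ds ls)).
apply: (@le_lt_trans _ _ (e / 2)); last lra.
rewrite -lee_fin -sumEFin; apply: le_trans h.
rewrite big_seq [leRHS]big_seq; apply: lee_sum => p ps.
have /and3P[p0 p12 p1] : unit_subitv p by case/andP : ds => /allP /(_ _ ps).
rewrite -tvB// lee_fin ger0_norm//.
by apply: le_trans (tv_ge acF p0 p12 p1); exact: normr_ge0.
Qed.

Lemma abs_contD F G : abs_cont F -> abs_cont G -> abs_cont (F \+ G).
Proof.
move=> aF aG e e0; have e20 : 0 < e / 2 by rewrite divr_gt0.
have [d1 d10 H1] := aF _ e20; have [d2 d20 H2] := aG _ e20.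
exists (Num.min d1 d2); first by rewrite lt_min d10.
move=> s ds; rewrite lt_min => /andP[/(H1 _ ds) h1 /(H2 _ ds) h2].
apply: (@le_lt_trans _ _ (total_incr F s + total_incr G s)); last lra.
rewrite /total_incr -big_split /=; apply: ler_sum => p _.
have -> : F p.2 + G p.2 - (F p.1 + G p.1) = (F p.2 - F p.1) + (G p.2 - G p.1).
  by ring.
exact: ler_normD.
Qed.

Lemma abs_contN F : abs_cont F -> abs_cont (\- F).
Proof.
move=> aF e /aF[d d0 H]; exists d => // s ds ls.
rewrite /total_incr; under eq_bigr do rewrite -opprD normrN.
exact: H.
Qed.

Lemma abs_cont_lipschitz F : (exists C, forall x y, 0 <= x -> x <= y -> y <= 1 ->
  `|F y - F x| <= C * (y - x)) -> abs_cont F.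
Proof.
move=> [C H] e e0; exists (e / (`|C| + 1)); first by rewrite divr_gt0// ltr_wpDl.
move=> s ds ls; apply: (@le_lt_trans _ _ ((`|C| + 1) * len s)).
  rewrite /total_incr /len mulr_sumr big_seq [leRHS]big_seq.
  apply: ler_sum => p ps.
  have /and3P[p0 p12 p1] : unit_subitv p by case/andP : ds => /allP /(_ _ ps).
  apply: le_trans (H _ _ p0 p12 p1) _; apply: ler_wpM2r; first by rewrite subr_ge0.
  by rewrite (le_trans (ler_norm _))// lerDl.
by rewrite mulrC -ltr_pdivlMr// ltr_wpDl.
Qed.

Lemma abs_cont_bounded F : abs_cont F -> exists2 M, 0 <= M & forall x, 0 <= x <= 1 -> `|F x| <= M.
Proof.
move=> acF; exists (`|F 0| + (tv F 1 - tv F 0)).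
  by rewrite addr_ge0// (le_trans _ (tv_ge acF _ _ _)).
move=> x /andP[x0 x1].
have -> : F x = F 0 + (F x - F 0) by ring.
apply: le_trans (ler_normD _ _) _; rewrite lerD2l.
apply: le_trans (tv_ge acF _ x0 x1) _ => //; rewrite lerD2r.
rewrite -subr_ge0; apply: le_trans (tv_ge acF x0 x1 _) => //.
Qed.

Lemma abs_contM F G : abs_cont F -> abs_cont G -> abs_cont (F \* G).
Proof.
move=> aF aG e e0.
have [M M0 FM] := abs_cont_bounded aF; have [N N0 GN] := abs_cont_bounded aG.
have K0 : 0 < M + N + 1 by rewrite ltr_wpDl// addr_ge0.
have e20 : 0 < e / 2 / (M + N + 1) by rewrite !divr_gt0.
have [d1 d10 H1] := aF _ e20; have [d2 d20 H2] := aG _ e20.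
exists (Num.min d1 d2); first by rewrite lt_min d10.
move=> s ds; rewrite lt_min => /andP[/(H1 _ ds) h1 /(H2 _ ds) h2].
apply: (@le_lt_trans _ _ ((M + N + 1) * (total_incr F s + total_incr G s))).
  rewrite /total_incr -big_split /= mulr_sumr big_seq [leRHS]big_seq.
  apply: ler_sum => p ps.
  have /and3P[p0 p12 p1] : unit_subitv p by case/andP : ds => /allP /(_ _ ps).
  have -> : F p.2 * G p.2 - (F p.1 * G p.1) =
    (F p.2 - F p.1) * G p.2 + F p.1 * (G p.2 - G p.1) by ring.
  apply: le_trans (ler_normD _ _) _; rewrite [leRHS]mulrDr !normrM; apply: lerD.
    rewrite mulrC; apply: ler_wpM2r => //.
    apply: le_trans (GN _ _) _; last lra.
    by rewrite p1 (le_trans p0).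
  apply: ler_wpM2r => //; apply: le_trans (FM _ _) _; last lra.
  by rewrite p0 (le_trans p12).
rewrite mulrC -ltr_pdivlMr//.
apply: lt_le_trans (ltrD h1 h2) _; rewrite -mulrDl.
by rewrite ler_wpM2r ?invr_ge0 ?(ltW K0)//; lra.
Qed.

End absolute_continuity.

(** * The fundamental theorem of calculus *)

Section ftc.
Context {R : realType}.
Notation lambda := (@lebesgue_measure R).

(** Finite measure bounds the interval, and openness keeps its left endpoint out, so that
    it lies in a half-open interval, whose Stieltjes measure is an increment.  The
    last two clauses locate the endpoints when disjoint intervals are compared. *)
Lemma open_itv_hull (I : set R) : open I -> is_interval I -> I !=set0 ->
  (lambda I < +oo)%E ->
  exists a b : R, [/\ a <= b, I `<=` `]a, b], ((b - a)%:E <= lambda I)%E,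
    (forall c, (forall x, I x -> x <= c) -> b <= c) &
    (forall c, (forall x, I x -> c <= x) -> c <= a)].
Proof.
move=> oI iI [x0 Ix0] fI.
have dist x y : I x -> I y -> x <= y -> ((y - x)%:E <= lambda I)%E.
  move=> Ix Iy xy; have -> : (y - x)%:E = lambda `[x, y].
    by rewrite lebesgue_measure_itv/= lte_fin; case: ltgtP xy => // -> _; rewrite subrr.
  apply: le_measure; rewrite ?inE; [exact: measurable_itv|exact: open_measurable|].
  by move=> z /=; rewrite in_itv/=; exact: iI Ix Iy z.
have lE : (lambda I = (fine (lambda I))%:E) by rewrite fineK// ge0_fin_numE.
set l := fine _ in lE.
have distl x y : I x -> I y -> y - x <= l.
  move=> Ix Iy; case: (leP x y) => xy.
    by rewrite -lee_fin -lE; exact: dist.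
  by apply: (@le_trans _ _ 0); [lra|rewrite /l fine_ge0].
have ubI : has_ubound I by exists (x0 + l) => y Iy; have := distl _ _ Ix0 Iy; lra.
have lbI : has_lbound I by exists (x0 - l) => y Iy; have := distl _ _ Iy Ix0; lra.
have infle x : I x -> inf I <= x by move=> Ix; exact: ge_inf.
have suple x : I x -> x <= sup I by move=> Ix; exact: ub_le_sup.
exists (inf I), (sup I); split.
- exact: le_trans (infle _ Ix0) (suple _ Ix0).
- move=> x Ix /=; rewrite in_itv/= suple// andbT.
  have [e /= e0 He] : nbhs_ball x I by rewrite nbhs_ballE; exact: open_nbhs_nbhs.
  have : I (x - e / 2).
    apply: He; rewrite /ball /= opprB addrC subrK ger0_norm; lra.
  move/infle; lra.
- rewrite lE lee_fin.
  have : sup I <= inf I + l.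
    apply: ge_sup; first by exists x0.
    move=> y Iy; rewrite -lerBlDr; apply: lb_le_inf; first by exists x0.
    by move=> x Ix; have := distl _ _ Ix Iy; lra.
  lra.
- by move=> c h; apply: ge_sup => //; exists x0.
- by move=> c h; apply: lb_le_inf => //; exists x0.
Qed.

Section monotone.
Variable (F : R -> R).
Hypotheses (acF : abs_cont F)
  (ndF : forall x y, 0 <= x -> x <= y -> y <= 1 -> F x <= F y).

Let K := F \o clamp.

Let K_nd : nondecreasing K.
Proof.
by move=> x y xy; apply: ndF; [exact: clamp_ge0|exact: le_clamp|exact: clamp_le1].
Qed.

Let K_rc : right_continuous K.
Proof. by apply: right_continuousW; exact: abs_cont_continuous. Qed.

HB.instance Definition _ := isCumulative.Build R _ R K K_nd K_rc.

Let m : {measure set (measurableTypeR R) -> \bar R} :=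
  lebesgue_stieltjes_measure (K : cumulative R R).

Let m_itv (a b : R) : a <= b -> m `]a, b]%classic = (K b - K a)%:E.
Proof.
move=> ab; rewrite -(wlength_itv_bnd K false false ab).
exact: (@measurable_mu_extE _ _ _ (wlength (K : cumulative R R)) _ (is_ocitv a b)).
Qed.

(** A Lebesgue-null set has an open neighbourhood of measure less than [d], and the
    components of that open set form a disjoint family of intervals: absolute
    continuity bounds the increment of [F], that is the Stieltjes measure, over any
    finite number of them. *)
Lemma stieltjes_dominated (A : set R) : measurable A -> lambda A = 0 -> m A = 0.
Proof.
move=> mA A0; apply/eqP; rewrite eq_le measure_ge0 andbT.
apply/lee_addgt0Pr => e e0; rewrite add0e.
have [d d0 H] := acF e0.
have [|U [oU AU UA]] := lebesgue_regularity_outer mA _ d0.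
  by apply: (@eq_ind_r _ 0%E (fun z => (z < +oo)%E) _ _ A0); exact: ltry.
have lU : (lambda U < d%:E)%E.
  apply: le_lt_trans UA.
  rewrite -[X in (lambda X <= _)%E](setDKU AU).
  apply: (le_trans (measureU2 _ _ _)) => //.
    by apply: measurableD => //; exact: open_measurable.
  by rewrite [X in (_ + X <= _)%E](_ : _ = 0%E) ?adde0; last exact: A0.
apply: (@le_trans _ _ (m U)).
  by rewrite le_measure// ?inE//; exact: open_measurable.
pose I := open_disjoint_itv oU.
have oI i : open (I i) by exact: open_disjoint_itv_open.
have mI i : measurable (I i) by exact: open_measurable.
have tI : trivIset setT I by exact: open_disjoint_itv_trivIset.
have UI : U = \bigcup_i I i by exact: open_disjoint_itv_bigcup.
have subU i : I i `<=` U by move=> x Ix; rewrite UI; exists i.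
have ends i : exists p : R * R, [/\ p.1 <= p.2, (m (I i) <= (K p.2 - K p.1)%:E)%E,
    ((p.2 - p.1)%:E <= lambda (I i))%E,
    I i = set0 -> p = (0, 0) &
    I i !=set0 -> (forall c, (forall x, I i x -> x <= c) -> p.2 <= c) /\
    (forall c, (forall x, I i x -> c <= x) -> c <= p.1)].
  have [I0|/set0P/negP/negPn/eqP I0] := pselect (I i !=set0); last first.
    exists (0, 0); rewrite /= !subrr I0 /m !measure0; split => //.
    by move=> [].
  have [|a [b [ab Iab ba bc ac]]] := open_itv_hull (oI i)
      (@open_disjoint_itv_is_interval _ _ oU i) I0.
    apply: (@le_lt_trans _ _ (lambda U)); last exact: lt_trans lU (ltry _).
    by rewrite le_measure ?inE//; exact: open_measurable.
  exists (a, b); split=> //=.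
  - rewrite -m_itv//; apply: le_measure => //; rewrite inE; first exact: mI.
    exact: measurable_itv.
  - by move=> Ie; move: I0; rewrite Ie => -[].
have {ends}[p /all_and5[p12 mp lp p0 pI]] := choice ends.
have mU : measurable (\bigcup_i I i) by exact: bigcup_measurable.
rewrite UI (measure_semi_bigcup m)//.
apply: lime_le.
  exact: is_cvg_nneseries.
apply: nearW => k; 
(* Clamping keeps the intervals disjoint and makes them subintervals of [0,1]. *)
pose q i := (clamp (p i).1, clamp (p i).2).
(* Disjoint intervals are ordered; an empty one was given both endpoints 0. *)
have sep i j : i != j -> nonoverlapping (q i) (q j).
  move=> ij.
  have [Ii|/set0P/negP/negPn/eqP /p0 pi0] := pselect (I i !=set0); last first.
    by apply/orP; left; rewrite /q pi0 /= clamp_id ?lexx ?ler01// clamp_ge0.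
  have [Ij|/set0P/negP/negPn/eqP /p0 pj0] := pselect (I j !=set0); last first.
    by apply/orP; right; rewrite /q pj0 /= clamp_id ?lexx ?ler01// clamp_ge0.
  have disj x y : I i x -> I j y -> x != y.
    move=> Ix Jy; apply/negP => /eqP xy; rewrite -xy in Jy.
    by move/negP : ij; apply; apply/eqP/(tI i j) => //; exists x.
  have [x0 Ix0] := Ii; have [y0 Iy0] := Ij.
  have itvI l : is_interval (I l) by exact: open_disjoint_itv_is_interval.
  have lee x y x' y' : I i x -> I j y -> I i x' -> I j y' -> x < y -> x' <= y'.
    move=> Ix Iy Ix' Iy' xy; rewrite leNgt; apply/negP => yx'.
    case: (leP x y') => xy'.
      have Iiy' : I i y' by apply: (itvI i x x') => //; rewrite xy' ltW.
      by have := disj _ _ Iiy' Iy'; rewrite eqxx.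
    have Ijx : I j x by apply: (itvI j y' y) => //; rewrite !ltW.
    by have := disj _ _ Ix Ijx; rewrite eqxx.
  have gee x y x' y' : I i x -> I j y -> I i x' -> I j y' -> y < x -> y' <= x'.
    move=> Ix Iy Ix' Iy' yx; rewrite leNgt; apply/negP => xy'.
    have := lee _ _ _ _ Ix' Iy' Ix Iy xy'; rewrite leNgt yx//.
  have [ubi lbi] := pI i Ii; have [ubj lbj] := pI j Ij.
  have /lt_total/orP[xy|yx] := disj _ _ Ix0 Iy0; apply/orP; [left|right];
    apply: le_clamp.
  - by apply: ubi => x Ix; apply: lbj => y Iy; exact: lee xy.
  - by apply: ubj => y Iy; apply: lbi => x Ix; exact: gee yx.
pose s := [seq q i | i <- iota 0 k].
have ds : disjoint_family s.
  apply/andP; split.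
    apply/allP => _ /mapP[i _ ->]; rewrite /unit_subitv /q /=.
    by rewrite clamp_ge0 clamp_le1 le_clamp.
  rewrite pairwise_map; apply: (@sub_in_pairwise _ predT (fun i j => i != j)).
  - by move=> i j _ _; exact: sep.
  - exact: all_predT.
  - by rewrite -uniq_pairwise iota_uniq.
have ls : len s < d.
  rewrite -lte_fin; apply: le_lt_trans lU.
  rewrite /len big_map -sumEFin UI (measure_semi_bigcup lambda)//.
  apply: (@le_trans _ _ (\sum_(0 <= i < k) lambda (I i))%E); last first.
    exact: nneseries_lim_ge.
  rewrite /index_iota subn0; apply: lee_sum => i _.
  apply: le_trans (lp i); rewrite lee_fin; exact: clampB_le.
have := H _ ds ls; rewrite /total_incr big_map => /ltW.
rewrite -lee_fin -sumEFin; apply: le_trans.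
rewrite /index_iota subn0; apply: lee_sum => i _.
apply: (le_trans (mp i)).
by rewrite lee_fin /K /= ler_norm.
Qed.

(** [g] is the Radon--Nikodym density of the Stieltjes measure of [F]. *)
Lemma monotone_ftc : exists2 g : R -> R, lambda.-integrable setT (EFin \o g) &
  forall x, 0 <= x <= 1 -> F x - F 0 = \int[lambda]_(t in `[0, x]) g t.
Proof.
have mD : measurable (`]0, 1] : set (measurableTypeR R)) by exact: measurable_itv.
have fD : (m `]0%R, 1%R]%classic < +oo)%E by rewrite m_itv// ltry.
pose nu : {finite_measure set (measurableTypeR R) -> \bar R} := mfrestr mD fD.
have dom : nu `<< lambda.
  apply/null_content_dominatesP => A mA A0; rewrite /nu /= /mfrestr /mrestr.
  apply: stieltjes_dominated; first exact: measurableI.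
  apply/eqP; rewrite eq_le measure_ge0 andbT -[leRHS]A0.
  by apply: le_measure; rewrite ?inE//; exact: measurableI.
have [f [f0 ffin intf fE]] := radon_nikodym_sigma_finite dom.
have fE' : f = EFin \o (fine \o f) by apply/funext => x /=; rewrite fineK.
exists (fine \o f); first by rewrite -fE'.
move=> x /andP[x0 x1].
rewrite /Rintegral (eq_integral f) => [|t _ /=]; last by rewrite fineK.
rewrite -fE; last exact: measurable_itv.
rewrite /nu /= /mfrestr /mrestr.
have -> : `[0, x]%classic `&` `]0, 1]%classic = `]0, x]%classic.
  apply/seteqP; split => [y [] /=|y /=]; rewrite !in_itv/=.
    by move=> /andP[_ yx] /andP[y0 _]; rewrite y0.
  by move=> /andP[y0 yx]; rewrite y0 yx (ltW y0) (le_trans yx).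
by rewrite -[RHS]/(fine (m _)) m_itv//= /K /= !clamp_id ?x0 ?lexx ?ler01.
Qed.

End monotone.

(** The fundamental theorem of calculus for absolutely continuous functions, by
    subtraction of the monotone case for [tv F] and [tv F - F]. *)
Lemma abs_cont_ftc F : abs_cont F -> exists g : R -> R,
  [/\ lambda.-integrable setT (EFin \o g),
      forall x, 0 <= x <= 1 -> F x - F 0 = \int[lambda]_(t in `[0, x]) g t &
      {ae lambda, forall x : R, x \in `]0, 1[ -> is_derive x 1 F (g x)}].
Proof.
move=> acF.
have [|g1 ig1 g1E] := @monotone_ftc (tv F) (abs_cont_tv acF).
  move=> x y x0 xy y1; rewrite -subr_ge0.
  exact: le_trans (normr_ge0 _) (tv_ge acF x0 xy y1).
have [|g2 ig2 g2E] := @monotone_ftc (tv F \- F) (abs_contD (abs_cont_tv acF) (abs_contN acF)).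
  move=> x y x0 xy y1 /=; have := le_trans (ler_norm _) (tv_ge acF x0 xy y1); lra.
have ig : lambda.-integrable setT (EFin \o (g1 \- g2)).
  by have := integrableB measurableT ig1 ig2; apply: eq_integrable.
have igS A : measurable A -> lambda.-integrable A (EFin \o (g1 \- g2)).
  by move=> mA; exact: integrableS ig.
have FE x : 0 <= x <= 1 -> F x - F 0 = \int[lambda]_(t in `[0, x]) (g1 t - g2 t).
  move=> x01; rewrite RintegralB//; [|exact: integrableS ig1|exact: integrableS ig2].
  by rewrite -g1E// -g2E//=; ring.
exists (g1 \- g2); split => //.
have locg : locally_integrable setT (g1 \- g2).
  by apply: open_integrable_locally => //; exact: openT.
have := @FTC1 R (g1 \- g2) (BLeft 0) (fun y => igS _ (measurable_itv _)) locg.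
apply: filterS; first exact: (ae_filter_ringOfSetsType lambda).
move=> x H; rewrite in_itv/= => /andP[x0 x1].
have [|dF FgE] := H; first by rewrite /= lte_fin.
have Fnear : \forall y \near x, \int[lambda]_(t in `[0, y]) (g1 t - g2 t) + F 0 = F y.
  near=> y; have : y \in `]0, 1[ by near: y; apply: near_in_itvoo; rewrite in_itv/= x0.
  by rewrite in_itv/= => /andP[y0 y1]; rewrite -FE ?subrK// !ltW.
apply: near_eq_is_derive Fnear _.
rewrite -[X in is_derive _ _ _ X]addr0; apply: is_deriveD.
by apply: DeriveDef; rewrite // -derive1E.
Unshelve. all: by end_near. Qed.

End ftc.

(** * Weak derivatives of absolutely continuous functions *)

Section w11.
Context {R : realType}.
Notation lambda := (@lebesgue_measure R).
Implicit Types F G phi : R -> R.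

Lemma abs_cont_measurable F : abs_cont F -> measurable_fun (`[0, 1] : set R) F.
Proof.
move=> aF; apply: (eq_measurable_fun (F \o clamp)).
  by move=> x; rewrite inE/= in_itv/= => x01; rewrite /= clamp_id.
apply: (@measurable_funS _ _ _ _ setT) => //.
by apply: continuous_measurable_fun; exact: abs_cont_continuous.
Qed.

Lemma C1_bounded_derivative phi : (forall x, derivable phi x 1) ->
  (forall x, derivable (derive1 phi) x 1) ->
  exists C, forall x, 0 <= x <= 1 -> `|derive1 phi x| <= C.
Proof.
move=> d1 d2.
have c' : continuous (derive1 phi).
  by move=> x; apply: differentiable_continuous; exact/derivable1_diffP.
have [c _ cmax] := @EVT_max R (fun x => `|derive1 phi x|) 0 1 ler01
  (continuous_subspaceT (fun x => continuous_comp (c' x) (@norm_continuous _ _ _))).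
by exists `|derive1 phi c| => x x01; apply: cmax; rewrite in_itv.
Qed.

Lemma C1_abs_cont phi : (forall x, derivable phi x 1) ->
  (forall x, derivable (derive1 phi) x 1) -> abs_cont phi.
Proof.
move=> d1 d2; have [C HC] := C1_bounded_derivative d1 d2.
have c0 : continuous phi.
  by move=> x; apply: differentiable_continuous; exact/derivable1_diffP.
apply: abs_cont_lipschitz; exists C => x y x0 xy y1.
have [z zxy ->] := @MVT_segment R phi (derive1 phi) x y xy
  (fun z _ => DeriveDef (d1 z) (esym (derive1E _ _))) (continuous_subspaceT c0).
rewrite normrM (ger0_norm (x := y - x)) ?subr_ge0//; apply: ler_wpM2r.
  by rewrite subr_ge0.
move: zxy; rewrite in_itv/= => /andP[xz zy].
by apply: HC; rewrite (le_trans x0)//= (le_trans zy).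
Qed.

Lemma abs_cont_bounded_on F : abs_cont F -> [bounded F x | x in `]0, 1[%classic].
Proof.
move=> /abs_cont_bounded[M M0 FM]; exists M; split; first exact: num_real.
move=> N MN x /=; rewrite in_itv/= => /andP[x0 x1].
by apply: le_trans (FM _ _) (ltW MN); rewrite !ltW.
Qed.

Lemma abs_cont_measurable_oo F : abs_cont F -> measurable_fun (`]0, 1[ : set R) F.
Proof.
move=> /abs_cont_measurable; apply: measurable_funS => //.
exact: subset_itv_oo_cc.
Qed.

Lemma abs_cont_integrableM F g : abs_cont F -> lambda.-integrable setT (EFin \o g) ->
  lambda.-integrable `]0, 1[ (EFin \o (g \* F)).
Proof.
move=> aF ig.
have ig01 : lambda.-integrable `]0, 1[%classic (EFin \o g) by exact: integrableS ig.
suff : lambda.-integrable `]0, 1[%classic ((EFin \o g) \* (EFin \o F))%E.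
  exact: eq_integrable.
apply: integrableMl => //; first exact: abs_cont_measurable_oo.
exact: abs_cont_bounded_on.
Qed.

Lemma bounded_integrable01 F : measurable_fun (`]0, 1[ : set R) F ->
  [bounded F x | x in `]0, 1[%classic] -> lambda.-integrable `]0, 1[ (EFin \o F).
Proof.
move=> mF bF; apply: measurable_bounded_integrable => //.
by rewrite /= lebesgue_measure_itv/= lte_fin ltr01 oppr0 adde0 ltry.
Qed.

(** The product of [F] and a test function is absolutely continuous and vanishes at
    0 and 1, so the integral of its derivative vanishes. *)
Lemma abs_cont_W11 F g : abs_cont F -> lambda.-integrable setT (EFin \o g) ->
  {ae lambda, forall x : R, x \in `]0, 1[ -> is_derive x 1 F (g x)} ->
  W11_derivative F g.
Proof.
move=> aF ig dF; split.
- apply: bounded_integrable01; first exact: abs_cont_measurable_oo.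
  exact: abs_cont_bounded_on.
- exact: integrableS ig.
move=> phi [dphi [a [b [a0 b1 supp]]]].
have d1 x : derivable phi x 1 by exact: (dphi 0).
have d2 x : derivable (derive1 phi) x 1 by exact: (dphi 1).
have aphi := C1_abs_cont d1 d2.
have [p [ip pE dp]] := abs_cont_ftc (abs_contM aF aphi).
have ip01 : lambda.-integrable `]0, 1[ (EFin \o p) by exact: integrableS ip.
have p0 : \int[lambda]_(t in `]0, 1[) p t = 0.
  rewrite Rintegral_itv_bndo_bndc// Rintegral_itv_obnd_cbnd; last first.
    exact: integrableS ip.
  have phi0 : phi 0 = 0 by apply: supp; rewrite in_itv/= leNgt a0.
  have phi1 : phi 1 = 0 by apply: supp; rewrite in_itv/= (leNgt 1 b) b1 andbF.
  by rewrite -pE ?ler01 ?lexx//= phi0 phi1 !mulr0 subrr.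
have iFphi : lambda.-integrable `]0, 1[ (EFin \o (F \* derive1 phi)).
  have [C HC] := C1_bounded_derivative d1 d2.
  have [M M0 FM] := abs_cont_bounded aF.
  apply: bounded_integrable01.
    apply: measurable_funM; first exact: abs_cont_measurable_oo.
    apply: (@measurable_funS _ _ _ _ setT) => //.
    apply: continuous_measurable_fun => x.
    by apply: differentiable_continuous; exact/derivable1_diffP.
  exists (M * C); split; first exact: num_real.
  move=> N MN x /=; rewrite in_itv/= => /andP[x0 x1]; apply: le_trans (ltW MN).
  by rewrite normrM; apply: ler_pM => //; [apply: FM|apply: HC]; rewrite !ltW.
have igphi : lambda.-integrable `]0, 1[ (EFin \o (g \* phi)).
  exact: abs_cont_integrableM.
apply/eqP; rewrite -addr_eq0 -RintegralD//; apply/eqP; rewrite -[RHS]p0.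
congr fine; apply: ae_eq_integral => //.
- by apply: (measurable_int lambda); apply: integrableD iFphi igphi.
- exact: measurable_int ip01.
move: dF dp; apply: filterS2; first exact: (ae_filter_ringOfSetsType lambda).
move=> x dF dp x01; have {}dF := dF x01; have {}dp := dp x01.
have dP := is_deriveM dF (DeriveDef (d1 x) (esym (derive1E _ _))).
rewrite -(@derive_val _ _ _ _ _ _ _ dp) (@derive_val _ _ _ _ _ _ _ dP).
by rewrite /GRing.scale/= (mulrC (phi x)).
Qed.

End w11.

(** * The Euclidean norm *)

Section euclidean_norm.
Context {R : realType}.

Section l2.
Variable I : finType.
Implicit Types a b : I -> R.

Let l2 a := Num.sqrt (\sum_i a i ^+ 2).

Let l2_sqr a : l2 a ^+ 2 = \sum_i a i ^+ 2.
Proof. by rewrite sqr_sqrtr// sumr_ge0// => i _; exact: sqr_ge0. Qed.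

Let l2_eq0 a : l2 a = 0 -> forall i, a i = 0.
Proof.
move=> a0 i; have : \sum_i a i ^+ 2 = 0 by rewrite -l2_sqr a0 expr0n.
move/eqP; rewrite psumr_eq0 => [/allP/(_ i)|j _]; last exact: sqr_ge0.
by rewrite mem_index_enum sqrf_eq0 => /(_ isT)/eqP.
Qed.

(** Cauchy--Schwarz, from the nonnegativity of the sum of the
    (|b| a_i - |a| b_i)^2. *)
Lemma sum_mul_le_sqrt a b :
  \sum_i a i * b i <= Num.sqrt (\sum_i a i ^+ 2) * Num.sqrt (\sum_i b i ^+ 2).
Proof.
rewrite -/(l2 a) -/(l2 b); have A0 : 0 <= l2 a by exact: sqrtr_ge0.
have B0 : 0 <= l2 b by exact: sqrtr_ge0.
have [/l2_eq0 a0|an0] := eqVneq (l2 a) 0.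
  by rewrite big1 ?mulr_ge0// => i _; rewrite a0 mul0r.
have [/l2_eq0 b0|bn0] := eqVneq (l2 b) 0.
  by rewrite big1 ?mulr_ge0// => i _; rewrite b0 mulr0.
have AB : 0 < l2 a * l2 b by rewrite mulr_gt0// lt_neqAle eq_sym ?an0 ?bn0.
rewrite -(ler_pM2l AB) -subr_ge0.
have : 0 <= \sum_i (l2 b * a i - l2 a * b i) ^+ 2.
  by apply: sumr_ge0 => i _; exact: sqr_ge0.
rewrite (eq_bigr (fun i => l2 b ^+ 2 * a i ^+ 2 +
  - (2 * (l2 a * l2 b)) * (a i * b i) + l2 a ^+ 2 * b i ^+ 2)); last first.
  by move=> i _; ring.
rewrite !big_split/= -!mulr_sumr -!l2_sqr; set S := \sum_(_ | _) _; lra.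
Qed.

Lemma sqrt_sum_sqrD_le a b : Num.sqrt (\sum_i (a i + b i) ^+ 2) <=
  Num.sqrt (\sum_i a i ^+ 2) + Num.sqrt (\sum_i b i ^+ 2).
Proof.
rewrite -[leLHS]/(l2 (fun i => a i + b i)) -/(l2 a) -/(l2 b).
rewrite -ler_sqr ?nnegrE ?addr_ge0 ?sqrtr_ge0// l2_sqr sqrrD !l2_sqr.
under eq_bigr do rewrite sqrrD.
rewrite !big_split/= lerD2r lerD2l -mulr2n lerMn2r/=.
exact: sum_mul_le_sqrt.
Qed.
End l2.

Section matrices.
Variables p q : nat.
Implicit Types A B : 'M[R]_(p, q).

Lemma enormE A : enorm A = Num.sqrt (\sum_(k : 'I_p * 'I_q) A k.1 k.2 ^+ 2).
Proof. by rewrite /enorm pair_bigA. Qed.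

Lemma enorm_ge0 A : 0 <= enorm A. Proof. exact: sqrtr_ge0. Qed.

Lemma enormD A B : enorm (A + B) <= enorm A + enorm B.
Proof.
rewrite !enormE; apply: le_trans (sqrt_sum_sqrD_le _ _).
by under eq_bigr do rewrite mxE.
Qed.

Lemma enormZ c A : enorm (c *: A) = `|c| * enorm A.
Proof.
rewrite !enormE -sqrtr_sqr -sqrtrM ?sqr_ge0// mulr_sumr.
by under eq_bigr do rewrite mxE exprMn.
Qed.

Lemma enorm0 : enorm (0 : 'M[R]_(p, q)) = 0.
Proof. by rewrite -[0]/((0 : 'M[R]_(p, q))) -(scale0r 0) enormZ normr0 mul0r. Qed.

Lemma enormN A : enorm (- A) = enorm A.
Proof. by rewrite -scaleN1r enormZ normrN1 mul1r. Qed.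

Lemma enormB A B : enorm (A - B) = enorm (B - A).
Proof. by rewrite -enormN opprB. Qed.

Lemma enorm_dist A B : `|enorm A - enorm B| <= enorm (A - B).
Proof.
have h (C D : 'M[R]_(p, q)) : enorm C - enorm D <= enorm (C - D).
  by rewrite lerBlDr; have := enormD (C - D) D; rewrite subrK.
by rewrite ler_norml h andbT lerNl opprB enormB h.
Qed.

Lemma enorm_sum (I : Type) (r : seq I) (P : pred I) (F : I -> 'M[R]_(p, q)) :
  enorm (\sum_(i <- r | P i) F i) <= \sum_(i <- r | P i) enorm (F i).
Proof.
elim/big_rec2 : _ => [|i x y _ h]; first by rewrite enorm0.
by apply: le_trans (enormD _ _) _; rewrite lerD2l.
Qed.

Lemma coord_le_enorm A i j : `|A i j| <= enorm A.
Proof.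
rewrite enormE -sqrtr_sqr ler_wsqrtr// (bigD1 (i, j))//= lerDl sumr_ge0// => k _.
exact: sqr_ge0.
Qed.

Lemma enorm_le_sum A : enorm A <= \sum_i \sum_j `|A i j|.
Proof.
rewrite enormE pair_bigA /= -[leRHS]ger0_norm ?sumr_ge0// -sqrtr_sqr ler_wsqrtr//.
rewrite expr2 mulr_suml; apply: ler_sum => k _.
rewrite -real_normK ?num_real// expr2 ler_wpM2l//.
by rewrite (bigD1 k)//= lerDl sumr_ge0.
Qed.

Lemma enorm_eq0 A : enorm A = 0 -> A = 0.
Proof.
move=> A0; apply/matrixP => i j; rewrite mxE; apply/eqP; rewrite -normr_eq0.
by rewrite eq_le normr_ge0 andbT -[leRHS]A0 coord_le_enorm.
Qed.

Lemma norm_coord_le A i j : `|A i j| <= `|A|.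
Proof.
rewrite [leRHS]/Num.Def.normr/= mx_normrE.
exact: (le_bigmax _ (fun k => `|A k.1 k.2|) (i, j)).
Qed.

Lemma enorm_le_norm A : enorm A <= (p * q)%:R * `|A|.
Proof.
rewrite enormE -[leRHS]ger0_norm ?mulr_ge0// -sqrtr_sqr ler_wsqrtr//.
apply: (@le_trans _ _ (\sum_(k : 'I_p * 'I_q) `|A| ^+ 2)).
  apply: ler_sum => k _; rewrite -real_normK ?num_real//.
  by rewrite ler_sqr ?nnegrE// norm_coord_le.
rewrite sumr_const card_prod !card_ord -[leLHS]mulr_natl exprMn.
by rewrite ler_wpM2r ?sqr_ge0// -natrX ler_nat; case: (p * q)%N => // k; rewrite leq_pmulr.
Qed.

Lemma norm_le_enorm A : `|A| <= enorm A.
Proof.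
rewrite /Num.Def.normr/= mx_normrE; apply: bigmax_le; first exact: enorm_ge0.
by move=> k _; exact: coord_le_enorm.
Qed.

End matrices.

Section duality.
Variable n : nat.
Implicit Types (v w : 'rV[R]_n) (a b : 'cV[R]_n).

Lemma pairingE v a : pairing v a = \sum_i v 0 i * a i 0.
Proof. by rewrite /pairing mxE. Qed.

Lemma dotvE v w : dotv v w = \sum_i v 0 i * w 0 i.
Proof. by rewrite /dotv pairingE; under eq_bigr do rewrite mxE. Qed.

Lemma enorm_rVE v : enorm v = Num.sqrt (\sum_i v 0 i ^+ 2).
Proof. by rewrite /enorm big_ord1. Qed.

Lemma enorm_sqr v : enorm v ^+ 2 = dotv v v.
Proof.
rewrite enorm_rVE sqr_sqrtr ?sumr_ge0// => [|i _]; last exact: sqr_ge0.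
by rewrite dotvE; under eq_bigr do rewrite expr2.
Qed.

Lemma dotvC v w : dotv v w = dotv w v.
Proof. by rewrite !dotvE; under eq_bigr do rewrite mulrC. Qed.

Lemma dotvDl u v w : dotv (u + v) w = dotv u w + dotv v w.
Proof. by rewrite /dotv /pairing mulmxDl mxE. Qed.

Lemma dotvZl c v w : dotv (c *: v) w = c * dotv v w.
Proof. by rewrite /dotv /pairing -scalemxAl mxE. Qed.

Lemma dotvBl u v w : dotv (u - v) w = dotv u w - dotv v w.
Proof. by rewrite -scaleN1r dotvDl dotvZl mulN1r. Qed.

Lemma dotvDr u v w : dotv u (v + w) = dotv u v + dotv u w.
Proof. by rewrite dotvC dotvDl !(dotvC u). Qed.

Lemma dotvZr c v w : dotv v (c *: w) = c * dotv v w.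
Proof. by rewrite dotvC dotvZl dotvC. Qed.

Lemma dotvBr u v w : dotv u (v - w) = dotv u v - dotv u w.
Proof. by rewrite dotvC dotvBl !(dotvC u). Qed.

Lemma dotv_le v w : dotv v w <= enorm v * enorm w.
Proof. by rewrite dotvE !enorm_rVE; exact: sum_mul_le_sqrt. Qed.

Lemma normr_dotv_le v w : `|dotv v w| <= enorm v * enorm w.
Proof.
rewrite ler_norml dotv_le andbT lerNl -mulN1r -dotvZl.
by apply: le_trans (dotv_le _ _) _; rewrite scaleN1r enormN.
Qed.

End duality.
End euclidean_norm.

(** * Derivatives along curves *)

#[global] Instance ae_lebesgue_filter (R : realType) :
  Filter (nbhs (almost_everywhere (@lebesgue_measure R))).
Proof. exact: ae_filter_ringOfSetsType. Qed.

Section curves.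
Context {R : realType} {n : nat}.
Notation lambda := (@lebesgue_measure R).
Implicit Types (g : R -> 'rV[R]_n) (f : 'rV[R]_n -> R).

Lemma abs_continuous_comp g f : abs_continuous g -> elipschitz f -> abs_cont (f \o g).
Proof.
move=> ag [L fL] e e0.
have L0 : 0 < `|L| + 1 by rewrite ltr_wpDl.
have [d d0 H] := ag _ (divr_gt0 e0 L0); exists d => // s ds ls.
have := H (size s) (fun i => (nth (0, 0) s i).1) (fun i => (nth (0, 0) s i).2).
have /andP[/allP s01 /(pairwiseP (0, 0)) sep] := ds.
rewrite -(big_mkord xpredT (fun i => (nth (0, 0) s i).2 - (nth (0, 0) s i).1)).
rewrite -(big_nth (0, 0) xpredT (fun p => p.2 - p.1)).
rewrite -(big_mkord xpredT (fun i => enorm (g (nth (0, 0) s i).2 - g (nth (0, 0) s i).1))).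
rewrite -(big_nth (0, 0) xpredT (fun p => enorm (g p.2 - g p.1))).
case/(_ _ _ ls)/Wrap => [i|i j ij|].
- have /and3P[-> -> ->] // : unit_subitv (nth (0, 0) s i).
  by apply: s01; exact: mem_nth.
- rewrite -subset0 => x /= []; rewrite !in_itv/= => /andP[ix xi] /andP[jx xj].
  have : nonoverlapping (nth (0, 0) s i) (nth (0, 0) s j).
    have [ltij|ltji|/ord_inj ijE] := ltngtP i j; last by rewrite ijE eqxx in ij.
      by apply: sep => //; rewrite inE.
    by rewrite nonoverlapping_sym; apply: sep => //; rewrite inE.
  by case/orP; lra.
move=> gs; apply: (@le_lt_trans _ _ ((`|L| + 1) * \sum_(p <- s) enorm (g p.2 - g p.1))).
  rewrite mulr_sumr; apply: ler_sum => p _; apply: le_trans (fL _ _) _.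
  by apply: ler_wpM2r; [exact: enorm_ge0|rewrite (le_trans (ler_norm _))// lerDl].
by rewrite mulrC -ltr_pdivlMr.
Qed.

Lemma elipschitz_coord (i : 'I_n) : elipschitz (fun x : 'rV[R]_n => x 0 i).
Proof.
exists 1 => x y; rewrite mul1r; have := coord_le_enorm (x - y) 0 i.
by rewrite !mxE.
Qed.

(** Coordinates are Lipschitz, so each coordinate of the curve is absolutely
    continuous. *)
Lemma abs_continuous_ae_derivable g : abs_continuous g ->
  {ae lambda, forall t : R, t \in `]0, 1[ -> derivable g t 1}.
Proof.
move=> ag.
have : {ae lambda, forall t : R, forall i : 'I_n, t \in `]0, 1[ ->
    derivable (fun t => g t 0 i) t 1}.
  apply: filter_forall => i.
  have [h [_ _]] := abs_cont_ftc (abs_continuous_comp ag (elipschitz_coord i)).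
  by apply: filterS => t H /H [].
apply: filterS => t H t01; apply/derivable_mxP => i j.
by rewrite (ord1 i); exact: H.
Qed.

(** A Lipschitz function does not distinguish a curve from its tangent line to first
    order, so a derivative along the curve is a directional derivative. *)
Lemma is_derive_along g f t d : elipschitz f -> derivable g t 1 ->
  is_derive t 1 (f \o g) d -> is_derive (g t) (derive1 g t) f d.
Proof.
move=> [L fL] dg [dfg dE].
have L0 : 0 < `|L| + 1 by rewrite ltr_wpDl.
suff H : (fun h => h^-1 *: (f (h *: derive1 g t + g t) - f (g t))) @ 0^' --> d.
  split; first exact: (cvgP d H).
  exact: (cvg_lim (@Rhausdorff R) H).
have H1 : (fun h => h^-1 *: ((f \o g) (h *: 1 + t) - (f \o g) t)) @ 0^' --> d.
  by rewrite -dE; exact: dfg.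
have H2 : (fun h => h^-1 *: (g (h *: 1 + t) - g t)) @ 0^' --> derive1 g t.
  by rewrite derive1E; exact: dg.
suff H3 : (fun h => h^-1 *: (f (h *: derive1 g t + g t) - f (g t)) -
   h^-1 *: ((f \o g) (h *: 1 + t) - (f \o g) t)) @ 0^' --> (0 : R).
  have H4 := cvgD H3 H1; rewrite add0r in H4.
  apply: cvg_trans (H4 _); apply: near_eq_cvg; near=> h.
  by rewrite -[LHS]/(_ - _ + _) subrK.
apply/cvgrPdist_le => e e0.
have eL : 0 < e / ((`|L| + 1) * n.+1%:R) by rewrite divr_gt0// mulr_gt0.
near=> h.
have h0 : h != 0 by near: h; exact: nbhs_dnbhs_neq.
rewrite sub0r normrN -scalerBr /= opprB addrA subrK.
rewrite normrZ; apply: (@le_trans _ _ (`|h^-1| * ((`|L| + 1) *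
    enorm (h *: derive1 g t + g t - g (h *: 1 + t))))).
  rewrite ler_wpM2l// (le_trans (fL _ _))// ler_wpM2r ?enorm_ge0//.
  by rewrite (le_trans (ler_norm _))// lerDl.
rewrite mulrCA -enormZ.
have -> : h^-1 *: (h *: derive1 g t + g t - g (h *: 1 + t)) =
    derive1 g t - h^-1 *: (g (h *: 1 + t) - g t).
  by rewrite -addrA scalerDr scalerA mulVf// scale1r -scalerN opprB.
apply: (@le_trans _ _ ((`|L| + 1) * (n.+1%:R * (e / ((`|L| + 1) * n.+1%:R))))).
  rewrite ler_wpM2l ?(ltW L0)//; apply: le_trans (enorm_le_norm _) _.
  rewrite mul1n; apply: ler_pM => //; first by rewrite ler_nat.
  by near: h; move/cvgrPdist_le : H2; apply.
rewrite (mulrA (`|L| + 1)) mulrC divfK// mulf_neq0// ?pnatr_eq0//; exact: lt0r_neq0.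
Unshelve. all: by end_near. Qed.

End curves.

(** * Evaluation of curves and test plans *)

Section evaluation.
Context {R : realType} {n : nat}.
Notation lambda := (@lebesgue_measure R).
Implicit Types (g h : curve R n) (t : R).

Lemma curve_clampE g t : g t = g (clamp t).
Proof. exact: curve_clamp. Qed.

Lemma curve_near g t (e : R) : 0 < e ->
  exists2 d, 0 < d & forall s, `|t - s| < d -> enorm (g t - g s) < e.
Proof.
move=> e0; have e'0 : 0 < e / n.+1%:R by rewrite divr_gt0.
have gt : g @ within `[0, 1] (nbhs (clamp t)) --> g (clamp t).
  have [+ _] := subspace_continuousP (`[0, 1]%classic : set R) (g : R -> 'rV[R]_n).
  by apply; [exact: curve_cont|rewrite /= in_itv/= clamp_ge0 clamp_le1].
move/cvgrPdist_lt : gt => /(_ _ e'0)[d /= d0 H]; exists d => // s ts.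
have sI : `[0, 1]%classic (clamp s) by rewrite /= in_itv/= clamp_ge0 clamp_le1.
have := H (clamp s) (le_lt_trans (dist_clamp_le _ _) ts) sI.
rewrite (curve_clampE g t) (curve_clampE g s) => gts.
apply: le_lt_trans (enorm_le_norm _) _; rewrite mul1n.
apply: (@le_lt_trans _ _ (n.+1%:R * `|g (clamp t) - g (clamp s)|)).
  by rewrite ler_wpM2r// ler_nat.
by rewrite mulrC -ltr_pdivlMr.
Qed.

Lemma curve_dist_ge g h t : enorm (g t - h t) <= curve_dist g h.
Proof.
rewrite (curve_clampE g t) (curve_clampE h t).
have tI : clamp t \in `[0, 1] by rewrite in_itv/= clamp_ge0 clamp_le1.
apply: ub_le_sup; last by exists (clamp t).
have c : continuous (fun s => enorm (g s - h s)).
  move=> s; apply/cvgrPdist_lt => e e0.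
  have e20 : 0 < e / 2 by rewrite divr_gt0.
  have [d1 d10 H1] := curve_near g s e20; have [d2 d20 H2] := curve_near h s e20.
  exists (Num.min d1 d2); first by rewrite /= lt_min d10.
  move=> r /=; rewrite lt_min => /andP[/H1 gr /H2 hr].
  apply: le_lt_trans (enorm_dist _ _) _.
  have -> : g s - h s - (g r - h r) = (g s - g r) - (h s - h r).
    by rewrite !opprB addrACA [- h s + _]addrC -[in RHS]addrACA.
  by apply: le_lt_trans (enormD _ _) _; rewrite enormN; lra.
have [c0 c01 cmax] := @EVT_max R (fun s => enorm (g s - h s)) 0 1 ler01
  (continuous_subspaceT c).
by exists (enorm (g c0 - h c0)) => _ [s /cmax ? <-].
Qed.

(** Joint measurability, which Fubini requires: if the curve is in the open set [B] at
    time [t], then it stays at a positive distance from the complement of [B]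
    during a rational interval of times around [t]; for each rational interval this
    is an open condition on the curve. *)
Lemma measurable_evaluation :
  measurable_fun setT (fun gt : curve R n * R => gt.1 gt.2).
Proof.
apply: (@measurability _ _ _ _ _ _ (@open 'rV[R]_n)) => // _ [B oB <-].
rewrite setTI.
pose U (pq : rat * rat) := [set g : curve R n | exists2 r : R, 0 < r &
  forall s, ratr pq.1 <= s <= ratr pq.2 -> forall y, enorm (g s - y) < r -> B y].
have mU pq : measurable (U pq).
  apply: sub_sigma_algebra => g [r r0 Hr]; exists (r / 2); first by rewrite divr_gt0.
  move=> h gh; exists (r / 2); first by rewrite divr_gt0.
  move=> s spq y hy; apply: Hr spq _ _.
  have -> : g s - y = (g s - h s) + (h s - y) by rewrite addrA subrK.
  apply: le_lt_trans (enormD _ _) _; have := curve_dist_ge g h s; lra.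
have -> : (fun gt : curve R n * R => gt.1 gt.2) @^-1` B =
    \bigcup_(pq in [set: rat * rat]) (U pq `*` `]ratr pq.1, ratr pq.2[%classic).
  apply/seteqP; split=> [[g t] /= Bg|[g t] [pq _ /= [[r r0 Hr]]]]; last first.
    rewrite in_itv/= => /andP[pt tq]; apply: (Hr t); first by rewrite !ltW.
    by rewrite subrr enorm0.
  have [r r0 Hr] : exists2 r : R, 0 < r & forall y, enorm (g t - y) < r -> B y.
    have [r /= r0 Hr] : nbhs_ball (g t) B by rewrite nbhs_ballE; exact: open_nbhs_nbhs.
    exists r => // y gy; apply: Hr; rewrite -ball_normE /=.
    exact: le_lt_trans (norm_le_enorm _) gy.
  have [d d0 Hd] := curve_near g t (divr_gt0 r0 (ltr0n R 2)).
  have /rat_in_itvoo[p /andP[tp pt]] : t - d < t by lra.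
  have /rat_in_itvoo[q /andP[tq qt]] : t < t + d by lra.
  rewrite !bnd_simp in tp pt tq qt.
  exists (p, q) => //=; rewrite in_itv/= pt tq; split=> //.
  exists (r / 2); first by rewrite divr_gt0.
  move=> s /andP[ps sq] y gsy; apply: Hr.
  have -> : g t - y = (g t - g s) + (g s - y) by rewrite addrA subrK.
  apply: le_lt_trans (enormD _ _) _.
  have : enorm (g t - g s) < r / 2 by apply: Hd; rewrite ltr_norml; lra.
  lra.
apply: countable_bigcupT_measurable => [|pq]; first exact: countableP.
by apply: measurableX => //; exact: measurable_itv.
Qed.

(** By Fubini: for each fixed time, the curves that are in the null set at that time are
    [pi]-negligible, since the time marginals of [pi] are dominated by a multiple of
    [mu]. *)
Lemma test_plan_ae_notin (mu : {measure set 'rV[R]_n -> \bar R})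
  (pi : probability (curve R n) R) (N : set 'rV[R]_n) :
  test_plan mu pi -> mu.-negligible N ->
  {ae pi, forall g : curve R n, {ae lambda, forall t : R, t \in `]0, 1[ -> ~ N (g t)}}.
Proof.
move=> [_ _ [C C0 piC]] [N' [mN' N'0 NN']].
pose E := (fun gt : curve R n * R => gt.1 gt.2) @^-1` N' `&` (setT `*` `]0, 1[%classic).
have mE : measurable E.
  apply: measurableI; last by apply: measurableX => //; exact: measurable_itv.
  by rewrite -[X in measurable X]setTI; exact: measurable_evaluation.
have := @indic_fubini_tonelli _ _ _ _ R pi lambda E mE.
rewrite indic_fubini_tonelli_FE// indic_fubini_tonelli_GE//=.
rewrite [RHS](_ : _ = 0)%E; last first.
  apply: integral0_eq => t _ /=.
  apply/eqP; rewrite eq_le measure_ge0 andbT.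
  have [t01|t01] := boolP (t \in `]0, 1[).
    apply: (@le_trans _ _ (C%:E * mu N'))%E; last by rewrite N'0 mule0.
    have : t \in `[0, 1] by apply: subset_itv_oo_cc.
    move=> /piC /(_ _ mN'); apply: le_trans.
    apply: le_measure; rewrite ?inE.
    - exact: measurable_ysection.
    - have -> : [set g : curve R n | N' (g t)] =
          ysection ((fun gt : curve R n * R => gt.1 gt.2) @^-1` N') t.
        by apply/seteqP; split => g /=; rewrite /ysection/= inE.
      apply: measurable_ysection.
      by rewrite -[X in measurable X]setTI; exact: measurable_evaluation.
    - by move=> g /=; rewrite /ysection/= inE => -[].
  rewrite (_ : ysection _ _ = set0) ?measure0//.
  rewrite -subset0 => g; rewrite /ysection/= inE => -[_ [_ /=]].
  by apply/negP.
move=> h.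
have [+ _] := @ae_eq_integral_abs _ _ _ pi setT measurableT _
  (measurable_fun_xsection lambda mE).
have -> : (\int[pi]_x `|(lambda \o xsection E) x| = 0)%E.
  by rewrite -[RHS]h; apply: eq_integral => g _; rewrite gee0_abs.
move=> /(_ erefl); apply: filterS => g /(_ I) gE.
apply: (@negligibleS _ _ _ lambda (xsection E g)); last first.
  by apply/negligibleP => //; exact: measurable_xsection.
move=> t /= /not_implyP[t01 /contrapT Ngt].
by rewrite /xsection/= inE; split; [exact: NN'|split].
Qed.

End evaluation.

(** * Weak upper gradients from differentials along a distribution *)

Section am.
Context {R : realType} {n : nat}.
Notation lambda := (@lebesgue_measure R).
Implicit Types (f : 'rV[R]_n -> R) (V : {vspace 'rV[R]_n}) (x v w : 'rV[R]_n).

(** The limit in the definition of the Alberti--Marchese gradient: [w] represents the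
    differential of [f] at [x] restricted to [V]. *)
Definition differential_along f x V w : Prop :=
  (fun v => (f (x + v) - f x - dotv w v) / enorm v)
    @ within [set v | v \in V] ((0 : 'rV[R]_n)^') --> (0 : R).

Lemma is_derive_differential_along f x V w v d : v \in V ->
  differential_along f x V w -> is_derive x v f d -> d = dotv w v.
Proof.
move=> vV H fd; suff dw : is_derive x v f (dotv w v).
  by rewrite -(@derive_val _ _ _ _ _ _ _ fd) (@derive_val _ _ _ _ _ _ _ dw).
suff dw : (fun h => h^-1 *: (f (h *: v + x) - f x)) @ 0^' --> dotv w v.
  split; first exact: (cvgP _ dw).
  exact: (cvg_lim (@Rhausdorff R) dw).
have [->|v0] := eqVneq v 0.
  rewrite [dotv w _](_ : _ = 0); last first.
    by have := dotvZr 0 w v; rewrite mul0r scale0r.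
  under eq_fun do rewrite scaler0 add0r subrr scaler0.
  exact: cvg_cst.
have ev0 : 0 < enorm v.
  by rewrite lt_neqAle enorm_ge0 andbT eq_sym; apply: contra_neq v0 => /enorm_eq0.
apply/cvgrPdist_lt => e e0.
move/cvgrPdist_lt : H => /(_ (e / enorm v) (divr_gt0 e0 ev0)).
move=> /nbhs_ballP[r /= r0 Hr].
have v'0 : 0 < `|v| by rewrite normr_gt0.
near=> h.
have h0 : h != 0 by near: h; exact: nbhs_dnbhs_neq.
have hv0 : h *: v != 0 by rewrite scaler_eq0 negb_or h0.
have hvr : ball 0 r (h *: v).
  rewrite -ball_normE /= sub0r normrN normrZ.
  rewrite -ltr_pdivlMr//; near: h; apply: dnbhs0_lt.
  by rewrite divr_gt0.
have := Hr _ hvr hv0 (memvZ h vV).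
rewrite /= sub0r normrN distrC.
have -> : h^-1 *: (f (h *: v + x) - f x) - dotv w v =
    h^-1 * (f (x + h *: v) - f x - dotv w (h *: v)).
  by rewrite dotvZr mulrBr mulKf// (addrC x).
rewrite !normrM !normfV enormZ !normrM normr_id (ger0_norm (enorm_ge0 v)).
by rewrite invfM mulrA ltr_pM2r ?invr_gt0// mulrC.
Unshelve. all: by end_near. Qed.

Variable mu : {measure set 'rV[R]_n -> \bar R}.

(** [f0] detects the directions of [V]: along almost every curve the velocity is a
    direction of differentiability of [f0], hence lies in [V], where [nabla]
    computes the derivative of [f]. *)
Lemma weak_upper_gradient_AM (V : Gr_distribution R n) f
    (nabla : 'rV[R]_n -> 'rV[R]_n) (f0 : 'rV[R]_n -> R) :
  elipschitz f -> enorm \o nabla \in Lfun mu 2%:E ->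
  {ae mu, forall x, differential_along f x (V x) (nabla x)} ->
  elipschitz f0 -> {ae mu, forall x, forall v, v \notin V x -> ~ derivable f0 x v} ->
  weak_upper_gradient mu f (enorm \o nabla).
Proof.
move=> fL nL fV f0L f0V; split => //; first by apply: aeW => x; exact: enorm_ge0.
move=> pi tp.
pose good x := differential_along f x (V x) (nabla x) /\
  forall v, v \notin V x -> ~ derivable f0 x v.
have neg : mu.-negligible (~` good).
  by move: fV f0V; apply: filterS2 => x; split.
have piN := test_plan_ae_notin tp neg.
have [piAC _ _] := tp.
move: piAC piN; apply: filterS2 => g [acg _] gN.
have [h [ih _ dh]] := abs_cont_ftc (abs_continuous_comp acg fL).
exists h; first by apply: abs_cont_W11 => //; exact: abs_continuous_comp.
have [h0 [_ _ dh0]] := abs_cont_ftc (abs_continuous_comp acg f0L).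
have dg := abs_continuous_ae_derivable acg.
have : {ae lambda, forall t : R, t \in `]0, 1[ ->
  [/\ good (g t), is_derive t 1 (f \o g) (h t), is_derive t 1 (f0 \o g) (h0 t)
    & derivable g t 1]}.
  move: dh0 dg; apply: filterS3 (filterI gN dh) => t [a1 a2] a3 a4 t01.
  by split; [apply: contrapT; exact: a1|exact: a2|exact: a3|exact: a4].
apply: filterS => t /[apply] -[[fVt f0Vt] dft df0t dgt] /=.
have vV : derive1 g t \in V (g t).
  apply/negPn/negP => /f0Vt; apply.
  by have [] := is_derive_along f0L dgt df0t.
rewrite (is_derive_differential_along vV fVt (is_derive_along fL dgt dft)).
exact: normr_dotv_le.
Qed.

End am.

(** * Smooth bump functions *)

Section flat.
Context {R : realType}.

(** The classical flat functions s^(-k) exp(-1/s) for s > 0.  The powers of 1/s are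
    there to make the family stable under differentiation. *)
Definition flat (k : nat) (s : R) : R :=
  if s <= 0 then 0 else s^-1 ^+ k * expR (- s^-1).

Lemma flat_le0 k s : s <= 0 -> flat k s = 0.
Proof. by rewrite /flat => ->. Qed.

Lemma flatE k s : 0 < s -> flat k s = s^-1 ^+ k * expR (- s^-1).
Proof. by rewrite /flat; case: ltP. Qed.

Lemma flat_gt0 k s : 0 < s -> 0 < flat k s.
Proof.
by move=> s0; rewrite flatE// mulr_gt0 ?expR_gt0// exprn_gt0 ?invr_gt0.
Qed.

(** From exp(y) >= y^(k+2) / (k+2)! at y = 1/s. *)
Lemma flat_le k s : 0 < s -> flat k s <= (k.+2)`!%:R * s ^+ 2.
Proof.
move=> s0; rewrite flatE//.
have y0 : 0 < s^-1 by rewrite invr_gt0.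
rewrite expRN ler_pdivrMr ?expR_gt0//.
have := expR_ge1Dxn k.+1 (ltW y0) => h.
have {}h : s^-1 ^+ k.+2 <= (k.+2)`!%:R * expR s^-1.
  rewrite mulrC -ler_pdivrMr ?ltr0n ?fact_gt0//.
  by apply: le_trans h; rewrite lerDr.
have -> : s^-1 ^+ k = s ^+ 2 * s^-1 ^+ k.+2.
  by rewrite -(addn2 k) exprD mulrCA -exprMn mulfV ?lt0r_neq0// expr1n mulr1.
by rewrite [leRHS]mulrAC mulrC ler_pM2r ?exprn_gt0.
Qed.

Lemma is_derive_flat k (s : R) : is_derive s 1 (flat k) (- k%:R * flat k.+1 s + flat k.+2 s).
Proof.
have [s0|s0|s0] := ltgtP s 0.
- rewrite !flat_le0 ?ltW// mulr0 addr0.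
  apply: (@near_eq_is_derive _ _ _ (cst 0)).
  by near=> y; rewrite flat_le0// ltW//; near: y; exact: lt_nbhsl.
- have s'0 : s != 0 by rewrite gt_eqF.
  apply: (@near_eq_is_derive _ _ _ ((fun y => y^-1 ^+ k) \* (fun y => expR (- y^-1)))).
    near=> y; rewrite flatE//; near: y; exact: lt_nbhsr.
  rewrite !flatE//.
  have iV : is_derive s 1 (fun y : R => y^-1) (- s ^- 2 *: 1).
    exact: (@is_deriveV R id s 1 1 s'0 (is_derive_id _ _)).
  have iX : is_derive s 1 (fun y : R => y^-1 ^+ k)
      ((k%:R * s^-1 ^+ k.-1) *: (- s ^- 2 *: 1)).
    by have := is_deriveX k iV; rewrite exprfctE.
  have iN : is_derive s 1 (fun y : R => - y^-1) (- (- s ^- 2 *: 1)) by exact: is_deriveN iV.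
  have iE := @is_derive1_comp R expR (fun y => - y^-1) s _ _ (is_derive_expR _) iN.
  apply: (is_derive_eq (is_deriveM iX iE)).
  rewrite /GRing.scale/= mulr1 -exprVn opprK.
  by case: k {iX} => [|k]; rewrite !exprS ?expr0/=; ring.
- rewrite s0 !flat_le0// mulr0 addr0.
  suff dw : (fun h => h^-1 *: (flat k (h *: 1 + 0) - flat k 0)) @ 0^' --> (0 : R).
    split; first exact: (cvgP _ dw).
    exact: (cvg_lim (@Rhausdorff R) dw).
  apply/cvgrPdist_le => e e0; near=> h.
  rewrite sub0r normrN (flat_le0 k (lexx 0)) subr0 addr0.
  have -> : (h *: 1 : R) = h by rewrite /GRing.scale/= mulr1.
  have [h0|h0] := leP h 0; first by rewrite flat_le0// scaler0 normr0 ltW.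
  rewrite normrZ !gtr0_norm ?flat_gt0 ?invr_gt0//.
  rewrite ler_pdivrMl//; apply: le_trans (flat_le k h0) _.
  rewrite expr2 mulrCA ler_pM2l// mulrC -ler_pdivlMr ?ltr0n ?fact_gt0//.
  apply: le_trans (ler_norm _) _; near: h; apply: dnbhs0_le.
  by rewrite divr_gt0// ltr0n fact_gt0.
Unshelve. all: by end_near. Qed.

Lemma derivable_flat k (s : R) : derivable (flat k) s 1.
Proof. by have [] := is_derive_flat k s. Qed.

End flat.

Section bump.
Context {R : realType} {n : nat} (c : R).
Implicit Types f g : 'rV[R]_n -> R.

Definition sqnorm (x : 'rV[R]_n) : R := \sum_i x 0 i ^+ 2.

(** A class of functions that contains the bump functions and is stable under
    directional derivatives, which makes all its members smooth. *)
Inductive bump_algebra : ('rV[R]_n -> R) -> Prop :=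
| bump_cst a : bump_algebra (cst a)
| bump_coord i : bump_algebra (fun x => x 0 i)
| bump_flat k : bump_algebra (fun x => flat k (c - sqnorm x))
| bump_add f g : bump_algebra f -> bump_algebra g -> bump_algebra (f \+ g)
| bump_mul f g : bump_algebra f -> bump_algebra g -> bump_algebra (f \* g).

Lemma bump_sum (F : 'I_n -> 'rV[R]_n -> R) : (forall i, bump_algebra (F i)) ->
  bump_algebra (fun x => \sum_i F i x).
Proof.
move=> bF; rewrite -(fct_sumE (index_enum _) xpredT F).
elim/big_ind : _ => //; [exact: bump_cst|exact: bump_add].
Qed.

Lemma differentiable_sqnorm x : differentiable sqnorm x.
Proof.
have -> : sqnorm = \sum_i (fun x : 'rV[R]_n => x 0 i ^+ 2).
  by rewrite fct_sumE.
apply: differentiable_sum => i.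
by have := differentiableX 1 (differentiable_coord x 0 i); rewrite exprfctE.
Qed.

Lemma is_derive_coord i (x v : 'rV[R]_n) :
  is_derive x v (fun x : 'rV[R]_n => x 0 i) (v 0 i).
Proof.
suff dw : (fun h : R => h^-1 *: ((h *: v + x) 0 i - x 0 i)) @ 0^' --> v 0 i.
  split; first exact: (cvgP _ dw).
  exact: (cvg_lim (@Rhausdorff R) dw).
apply: cvg_near_cst; near=> h.
have h0 : h != 0 by near: h; exact: nbhs_dnbhs_neq.
by rewrite !mxE addrK /GRing.scale/= mulKf.
Unshelve. all: by end_near. Qed.

Lemma is_derive_sqnorm (x v : 'rV[R]_n) :
  is_derive x v sqnorm (\sum_i 2 * v 0 i * x 0 i).
Proof.
have -> : sqnorm = \sum_i (fun x : 'rV[R]_n => x 0 i ^+ 2) by rewrite fct_sumE.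
apply: is_derive_sum => i.
have := is_deriveX 2 (is_derive_coord i x v); rewrite exprfctE => h.
by apply: (is_derive_eq h); rewrite /GRing.scale/= expr1; ring.
Qed.

Lemma flat_sqnorm_differentiable k x : differentiable (fun x => flat k (c - sqnorm x)) x.
Proof.
apply: (@differentiable_comp _ _ _ _ (fun x => c - sqnorm x) (flat k)).
  by apply: differentiableB; [exact: differentiable_cst|exact: differentiable_sqnorm].
by apply/derivable1_diffP; exact: derivable_flat.
Qed.

Lemma is_derive_flat_sqnorm k x v :
  is_derive x v (fun x => flat k (c - sqnorm x))
   ((- k%:R * flat k.+1 (c - sqnorm x) + flat k.+2 (c - sqnorm x)) *
    (- \sum_i 2 * v 0 i * x 0 i)).
Proof.
have dq : differentiable (fun x => c - sqnorm x) x.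
  by apply: differentiableB; [exact: differentiable_cst|exact: differentiable_sqnorm].
have iq : is_derive x v (fun x => c - sqnorm x) (- \sum_i 2 * v 0 i * x 0 i).
  rewrite -[X in is_derive _ _ _ X]add0r.
  exact: (is_deriveD (is_derive_cst _ _ _) (is_deriveN (is_derive_sqnorm x v))).
have dF : differentiable (flat k) (c - sqnorm x).
  by apply/derivable1_diffP; exact: derivable_flat.
apply: DeriveDef; first exact/diff_derivable/flat_sqnorm_differentiable.
rewrite deriveE; last exact: flat_sqnorm_differentiable.
rewrite (diff_comp dq dF) /= -(deriveE _ dq) (@derive_val _ _ _ _ _ _ _ iq).
rewrite deriv1E; last exact: derivable_flat.
rewrite derive1E (@derive_val _ _ _ _ _ _ _ (is_derive_flat k _)).
by rewrite /GRing.scale/= mulrC.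
Qed.

Lemma bump_algebra_differentiable f : bump_algebra f ->
  (forall x, differentiable f x) /\ forall v, bump_algebra ('D_v f).
Proof.
elim=> {f} [a|i|k|f g bf [df Df] bg [dg Dg]|f g bf [df Df] bg [dg Dg]].
- split=> [x|v]; first exact: differentiable_cst.
  rewrite (_ : 'D_v _ = cst 0); first exact: bump_cst.
  by apply/funext => x; rewrite derive_cst.
- split=> [x|v]; first exact: differentiable_coord.
  rewrite (_ : 'D_v _ = cst (v 0 i)); first exact: bump_cst.
  by apply/funext => x; rewrite (@derive_val _ _ _ _ _ _ _ (is_derive_coord i x v)).
- split=> [x|v]; first exact: flat_sqnorm_differentiable.
  rewrite (_ : 'D_v _ = (cst (- k%:R) \* (fun x => flat k.+1 (c - sqnorm x)) \+
      (fun x => flat k.+2 (c - sqnorm x))) \*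
      (cst (-1) \* (fun x => \sum_i 2 * v 0 i * x 0 i))).
    apply: bump_mul; first apply: bump_add; last first.
    - apply: bump_mul; first exact: bump_cst.
      by apply: bump_sum => i; apply: bump_mul; [exact: bump_cst|exact: bump_coord].
    - exact: bump_flat.
    - by apply: bump_mul; [exact: bump_cst|exact: bump_flat].
  apply/funext => x; rewrite (@derive_val _ _ _ _ _ _ _ (is_derive_flat_sqnorm k x v)).
  by rewrite /= mulN1r.
- split=> [x|v]; first exact: differentiableD.
  rewrite (_ : 'D_v _ = 'D_v f \+ 'D_v g); first exact: bump_add.
  by apply/funext => x; rewrite deriveD//; exact: diff_derivable.
- split=> [x|v]; first exact: differentiableM.
  rewrite (_ : 'D_v _ = f \* 'D_v g \+ g \* 'D_v f).
    by apply: bump_add; exact: bump_mul.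
  by apply/funext => x; rewrite deriveM//; exact: diff_derivable.
Qed.

Lemma bump_algebra_smooth f : bump_algebra f -> smooth f.
Proof.
move=> bf s; suff : bump_algebra (foldr (fun v g => 'D_v g) f s).
  by move=> /bump_algebra_differentiable[].
by elim: s => //= v s /bump_algebra_differentiable[_ +]; exact.
Qed.

Lemma continuous_sqnorm : continuous sqnorm.
Proof. by move=> x; exact/differentiable_continuous/differentiable_sqnorm. Qed.

Lemma closed_sqnorm_le : closed [set x | sqnorm x <= c].
Proof. exact: ((continuous_closedP sqnorm).1 continuous_sqnorm _ (@closed_le _ c)). Qed.

Lemma compact_sqnorm_le : compact [set x | sqnorm x <= c].
Proof.
apply: bounded_closed_compact; last exact: closed_sqnorm_le.
exists (`|c| + 1); split; first exact: num_real.
move=> M cM x /= xc; apply: (@le_trans _ _ (`|c| + 1)); last exact: ltW.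
apply: le_trans (norm_le_enorm x) _; rewrite enorm_rVE -/(sqnorm x).
rewrite -(@ler_sqr _ (Num.sqrt _)) ?nnegrE ?sqrtr_ge0 ?addr_ge0//.
rewrite sqr_sqrtr; last by apply: sumr_ge0 => i _; exact: sqr_ge0.
have := ler_norm c; have := normr_ge0 c; nra.
Qed.

Lemma sqnorm_compactly_supported f : (forall x, c <= sqnorm x -> f x = 0) ->
  compactly_supported f.
Proof.
move=> f0; apply: (subclosed_compact _ compact_sqnorm_le); first exact: closed_closure.
rewrite [X in _ `<=` X](closure_id _).1; last exact: closed_sqnorm_le.
apply: closure_subset => x /= fx.
by rewrite leNgt; apply/negP => /ltW /f0/eqP; rewrite (negbTE fx).
Qed.

Lemma Cc_infty_bump p : bump_algebra p ->
  Cc_infty (fun x => p x * flat 0 (c - sqnorm x)).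
Proof.
move=> bp; split.
  by apply: bump_algebra_smooth; apply: bump_mul => //; exact: bump_flat.
by apply: sqnorm_compactly_supported => x cx; rewrite flat_le0 ?subr_le0// mulr0.
Qed.

End bump.

(** * Bounded functions and Lipschitz functions *)

Section bounded_lfun.
Context d {T : measurableType d} {R : realType} (mu : {measure set T -> \bar R}).

Lemma bounded_Lfun_oo (f : T -> R) (C : R) : measurable_fun setT f ->
  (forall x, `|f x| <= C) -> f \in Lfun mu +oo%E.
Proof.
move=> mf fC; apply/andP; split; first by rewrite inE.
rewrite inE /= /finite_norm unlock /Lnorm; case: ifPn => _; last exact: ltry.
apply: (@le_lt_trans _ _ C%:E); last exact: ltry.
by apply/ess_supP; apply: aeW => x /=; rewrite lee_fin.
Qed.

Lemma bounded_Lfun2 (f : T -> R) (C : R) (D : set T) : measurable_fun setT f ->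
  measurable D -> (mu D < +oo)%E ->
  (forall x, `|f x| <= C) -> (forall x, ~ D x -> f x = 0) -> f \in Lfun mu 2%:E.
Proof.
move=> mf mD Doo fC f0; apply/andP; split; first by rewrite inE.
rewrite inE /= /finite_norm unlock /Lnorm; apply: poweR_lty.
apply: (@le_lt_trans _ _ (\int[mu]_(x in D) (C ^+ 2)%:E)%E); last first.
  by rewrite integral_cst// lte_mul_pinfty// lee_fin sqr_ge0.
rewrite [leRHS]integral_mkcond.
have E x : (`|(EFin \o f) x| `^ 2 = (f x ^+ 2)%:E)%E.
  by rewrite /= powR_mulrn// real_normK ?num_real.
under eq_integral do rewrite E.
apply: ge0_le_integral => //.
- by move=> x _; rewrite lee_fin sqr_ge0.
- by apply/measurable_EFinP; exact: measurable_funX.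
- by apply/(measurable_restrictT _ mD); exact: measurable_cst.
move=> x _; rewrite /patch; case: ifPn => [_|].
  by rewrite lee_fin -real_normK ?num_real// ler_sqr ?nnegrE// (le_trans _ (fC x)).
by rewrite notin_setE => /f0 ->; rewrite expr0n.
Qed.

End bounded_lfun.

Section line.
Context {R : realType} {n : nat}.
Implicit Types f : 'rV[R]_n -> R.

Lemma derive_pairing f x v : differentiable f x -> 'D_v f x = pairing v (differential f x).
Proof.
move=> df; rewrite deriveE// {1}(row_sum_delta v) linear_sum pairingE.
by apply: eq_bigr => i _; rewrite linearZ /= -deriveE// mxE.
Qed.

Lemma is_derive_line f x v (t : R) : differentiable f (t *: v + x) ->
  is_derive t 1 (fun t => f (t *: v + x)) ('D_v f (t *: v + x)).
Proof.
move=> df.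
have E : (fun h : R => h^-1 *: (f ((h *: 1 + t) *: v + x) - f (t *: v + x))) =
    (fun h : R => h^-1 *: (f (h *: v + (t *: v + x)) - f (t *: v + x))).
  apply/funext => h; congr (_ *: (f _ - _)).
  by rewrite [h *: _]mulr1 scalerDl addrA.
have := derivableP (diff_derivable (v := v) df).
by case=> d1 d2; split; rewrite /derivable /derive E.
Qed.

(** By the mean value theorem on segments. *)
Lemma bounded_derivative_elipschitz f (C : 'I_n -> R) :
  (forall x, differentiable f x) ->
  (forall i x, `|'D_(delta_mx 0 i) f x| <= C i) -> elipschitz f.
Proof.
move=> df fC; exists (\sum_i C i) => y x; pose v := y - x.
have c1 : {within `[0, 1], continuous (fun t : R => f (t *: v + x))}.
  apply: continuous_subspaceT => t; apply: differentiable_continuous.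
  by apply/derivable1_diffP; case: (is_derive_line (df (t *: v + x))).
have [t _] := @MVT_segment R (fun t : R => f (t *: v + x))
  (fun t => 'D_v f (t *: v + x)) 0 1 ler01 (fun t _ => is_derive_line (df _)) c1.
rewrite scale1r scale0r add0r subrK subr0 mulr1 => ->.
rewrite derive_pairing// pairingE mulr_suml.
apply: le_trans (ler_norm_sum _ _ _) _; apply: ler_sum => i _.
by rewrite normrM mulrC mxE; apply: ler_pM => //; exact: coord_le_enorm.
Qed.

End line.

(** * Borel measurability and cutoff functions *)

Section borel.
Context {R : realType} {n : nat}.

Lemma continuous_mx_measurable (p q : nat) (f : 'rV[R]_n -> 'M[R]_(p, q)) :
  continuous f -> measurable_fun setT f.
Proof.
move=> cf; apply: (@measurability _ _ _ _ _ _ (@open 'M[R]_(p, q))) => // _ [B oB <-].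
by rewrite setTI; apply: sub_sigma_algebra; exact: (continuousP f).1.
Qed.

Lemma continuous_mx_real_measurable (p q : nat) (f : 'M[R]_(p, q) -> R) :
  continuous f -> measurable_fun setT f.
Proof.
move=> cf; apply: (measurability _ (RGenOInfty.measurableE R)) => _ [_ [a ->] <-].
rewrite setTI; apply: sub_sigma_algebra.
by apply: (continuousP f).1 => //; exact: interval_open.
Qed.

Lemma continuous_mxP (T : topologicalType) (p q : nat) (f : T -> 'M[R]_(p, q)) :
  (forall i j, continuous (fun x => f x i j)) -> continuous f.
Proof.
move=> cf x A [P nP PA]; rewrite /= nbhs_filterE.
have : \forall y \near x, forall i j, P i j (f y i j).
  by apply: filter_forall => i; apply: filter_forall => j; exact: cf.
by apply: filterS => y Py; exact: PA.
Qed.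

Lemma continuous_enorm (p q : nat) : continuous (@enorm R p q).
Proof.
move=> A U /nbhs_ballP[e /= e0 eU].
have e'0 : 0 < e / (p * q).+1%:R by rewrite divr_gt0.
rewrite /= nbhs_filterE; apply/nbhs_ballP; exists (e / (p * q).+1%:R) => //= B.
rewrite -ball_normE /= => AB; apply: eU; rewrite -ball_normE /=.
apply: le_lt_trans (enorm_dist _ _) _; apply: le_lt_trans (enorm_le_norm _) _.
apply: (@le_lt_trans _ _ ((p * q).+1%:R * `|A - B|)).
  by rewrite ler_wpM2r// ler_nat.
by rewrite mulrC -ltr_pdivlMr.
Qed.

Lemma measurable_enorm (p q : nat) : measurable_fun setT (@enorm R p q).
Proof. apply: continuous_mx_real_measurable; exact: continuous_enorm. Qed.

Lemma measurable_coord (p q : nat) i j :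
  measurable_fun setT (fun A : 'M[R]_(p, q) => A i j).
Proof. apply: continuous_mx_real_measurable; exact: coord_continuous. Qed.

End borel.

Section bump_l2.
Context {R : realType} {n : nat} (c : R).
Implicit Types f p : 'rV[R]_n -> R.
Notation supp := [set x : 'rV[R]_n | sqnorm x <= c].
Notation cutoff := (fun x : 'rV[R]_n => flat 0 (c - sqnorm x)).

Lemma measurable_sqnorm_le : measurable supp.
Proof.
rewrite -[supp]setCK; apply: measurableC; apply: sub_sigma_algebra.
by rewrite /= openC; exact: closed_sqnorm_le.
Qed.

Lemma bump_bounded f : bump_algebra c f -> (forall x, c <= sqnorm x -> f x = 0) ->
  exists C, forall x, `|f x| <= C.
Proof.
move=> bf f0.
have cf : continuous f.
  move=> x; apply: differentiable_continuous.
  by case: (bump_algebra_differentiable bf).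
have [M [_ HM]] := compact_bounded (continuous_compact (continuous_subspaceT cf) (@compact_sqnorm_le R n c)).
exists (`|M| + 1) => x; have [cx|xc] := leP c (sqnorm x).
  by rewrite f0// normr0 addr_ge0.
apply: (HM (`|M| + 1)); first by rewrite (le_lt_trans (ler_norm _))// ltrDl.
by exists x => //=; exact: ltW.
Qed.

Lemma bump_measurable f : bump_algebra c f -> measurable_fun setT f.
Proof.
move=> bf; apply: continuous_mx_real_measurable => x; apply: differentiable_continuous.
by case: (bump_algebra_differentiable bf).
Qed.

Variable mu : {measure set 'rV[R]_n -> \bar R}.
Hypothesis mu_radon : radon mu.

Lemma bump_L2 f : bump_algebra c f -> (forall x, c <= sqnorm x -> f x = 0) ->
  f \in Lfun mu 2%:E.
Proof.
move=> bf f0; have [C fC] := bump_bounded bf f0.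
apply: (bounded_Lfun2 (bump_measurable bf) measurable_sqnorm_le _ fC).
  exact: (mu_radon (@compact_sqnorm_le R n c)).
by move=> x /negP; rewrite -ltNge => /ltW /f0.
Qed.

Variable p : 'rV[R]_n -> R.
Hypothesis bp : bump_algebra c p.
Let F := p \* cutoff.

Let bF : bump_algebra c F. Proof. by apply: bump_mul => //; exact: bump_flat. Qed.

Let F0 x : c <= sqnorm x -> F x = 0.
Proof. by move=> cx; rewrite /F /= flat_le0 ?mulr0// subr_le0. Qed.

Let dF x : differentiable F x.
Proof. by case: (bump_algebra_differentiable bF). Qed.

Let bdF v : bump_algebra c ('D_v F).
Proof. by case: (bump_algebra_differentiable bF). Qed.

Let dF0 v x : c <= sqnorm x -> 'D_v F x = 0.
Proof.
move=> cx; rewrite deriveM; last 2 first.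
- by apply: diff_derivable; case: (bump_algebra_differentiable bp).
- by apply: diff_derivable; exact: flat_sqnorm_differentiable.
rewrite (@derive_val _ _ _ _ _ _ _ (is_derive_flat_sqnorm c 0 x v)).
by rewrite !flat_le0 ?subr_le0// mulr0 addr0 mul0r scaler0 add0r scale0r.
Qed.

Lemma cutoff_Cc_infty : Cc_infty F.
Proof. exact: Cc_infty_bump. Qed.

Lemma cutoff_L2 : F \in Lfun mu 2%:E.
Proof. exact: bump_L2. Qed.

(** The partial derivatives are continuous with compact support, hence bounded. *)
Lemma cutoff_elipschitz : elipschitz F.
Proof.
have /choice[C HC] : forall i : 'I_n, exists C, forall x, `|'D_(delta_mx 0 i) F x| <= C.
  by move=> i; apply: bump_bounded => // x; exact: dF0.
exact: (bounded_derivative_elipschitz dF HC).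
Qed.

Lemma cutoff_differential_elt : nm_elt (differential F : L2fields mu n 1).
Proof.
have cd : continuous (differential F).
  apply: continuous_mxP => i j.
  rewrite (_ : (fun x => _) = 'D_(delta_mx 0 i) F); last first.
    by apply/funext => x; rewrite mxE.
  move=> x; apply: differentiable_continuous.
  by case: (bump_algebra_differentiable (bdF (delta_mx 0 i))).
have md : measurable_fun setT (differential F) by exact: continuous_mx_measurable.
split => //.
have /choice[C HC] : forall i : 'I_n, exists C, forall x, `|'D_(delta_mx 0 i) F x| <= C.
  by move=> i; apply: bump_bounded => // x; exact: dF0.
apply: (@bounded_Lfun2 _ _ _ _ _ (\sum_i `|C i|) supp).
- by apply: measurableT_comp; [exact: measurable_enorm|exact: md].
- exact: measurable_sqnorm_le.
- exact: (mu_radon (@compact_sqnorm_le R n c)).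
- move=> x; rewrite ger0_norm ?enorm_ge0//.
  apply: le_trans (enorm_le_sum _) _; apply: ler_sum => i _.
  by rewrite big_ord1 mxE (le_trans (HC i x))// ler_norm.
- move=> x /negP; rewrite -ltNge => /ltW cx.
  rewrite /= [differential F x](_ : _ = 0) ?enorm0//.
  by apply/matrixP => i j; rewrite !mxE dF0.
Qed.

End bump_l2.

(** * Orthogonal projections and the Hausdorff distance *)

Section projection.
Context {R : realType} {n : nat}.
Implicit Types (V W : {vspace 'rV[R]_n}) (e u v w : 'rV[R]_n).

Lemma dotv_eq0 v : dotv v v = 0 -> v = 0.
Proof.
rewrite -enorm_sqr => /eqP; rewrite sqrf_eq0 => /eqP; exact: enorm_eq0.
Qed.

Definition is_oproj V e p := p \in V /\ forall v, v \in V -> dotv (e - p) v = 0.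

(** If the rows of A form a basis of V, the projection is e A^T (A A^T)^(-1) A; the
    Gram matrix A A^T is invertible since x A A^T = 0 implies |x A|^2 = 0. *)
Lemma oproj_exists V e : exists p, is_oproj V e p.
Proof.
pose A : 'M[R]_(\dim V, n) := \matrix_(i < \dim V) (vbasis V)`_i.
have rowA (x : 'rV_(\dim V)) : x *m A = \sum_i x 0 i *: (vbasis V)`_i.
  rewrite mulmx_sum_row; apply: eq_bigr => i _; by rewrite rowK.
have Gunit : A *m A^T \in unitmx.
  rewrite -row_free_unit; apply: inj_row_free => x xG.
  have : dotv (x *m A) (x *m A) = 0.
    by rewrite /dotv /pairing trmx_mul mulmxA -(mulmxA x) xG mul0mx mxE.
  move/dotv_eq0; rewrite rowA => x0.
  have /freeP fV := basis_free (vbasisP V).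
  by apply/rowP => i; rewrite mxE; exact: (fV (fun i => x 0 i)).
exists (e *m A^T *m invmx (A *m A^T) *m A); split.
  rewrite rowA; apply: memv_suml => i _; apply: memvZ; apply: vbasis_mem.
  by rewrite mem_nth// size_tuple.
move=> v vV; have vE : v = (\row_i coord (vbasis V) i v) *m A.
  by rewrite rowA {1}(coord_vbasis vV); apply: eq_bigr => i _; rewrite mxE.
rewrite vE /dotv /pairing trmx_mul mulmxA mulmxBl.
by rewrite -!mulmxA (mulVmx Gunit) mulmx1 subrr mul0mx mxE.
Qed.

Definition oproj V e := sval (cid (oproj_exists V e)).

Lemma oprojP V e : is_oproj V e (oproj V e).
Proof. by rewrite /oproj; case: cid. Qed.

Lemma oproj_mem V e : oproj V e \in V. Proof. by case: (oprojP V e). Qed.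

Lemma oproj_dotv V e v : v \in V -> dotv (oproj V e) v = dotv e v.
Proof.
by case: (oprojP V e) => _ h vV; apply/eqP; rewrite eq_sym -subr_eq0 -dotvBl h.
Qed.

Lemma enorm_oproj_le V e : enorm (oproj V e) <= enorm e.
Proof.
have [->|p0] := eqVneq (enorm (oproj V e)) 0; first exact: enorm_ge0.
have p'0 : 0 < enorm (oproj V e) by rewrite lt_neqAle eq_sym p0 enorm_ge0.
rewrite -(ler_pM2r p'0) -expr2 enorm_sqr oproj_dotv ?oproj_mem//.
exact: dotv_le.
Qed.

Lemma enorm_oproj_compl_le V e : enorm (e - oproj V e) <= enorm e.
Proof.
have [->|p0] := eqVneq (enorm (e - oproj V e)) 0; first exact: enorm_ge0.
have p'0 : 0 < enorm (e - oproj V e) by rewrite lt_neqAle eq_sym p0 enorm_ge0.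
rewrite -(ler_pM2r p'0) -expr2 enorm_sqr {1}dotvBl.
have [_ h] := oprojP V e.
by rewrite [dotv (oproj V e) _]dotvC h ?oproj_mem// subr0; exact: dotv_le.
Qed.

Lemma dotv_delta v i : dotv v (delta_mx 0 i) = v 0 i.
Proof.
rewrite dotvE (bigD1 i)//= mxE !eqxx mulr1 big1 ?addr0// => j ji.
by rewrite mxE (negbTE ji) andbF mulr0.
Qed.

Lemma enorm_delta i : enorm (delta_mx 0 i : 'rV[R]_n) = 1.
Proof.
apply/eqP; rewrite -(@eqrXn2 _ 2) ?enorm_ge0// enorm_sqr dotv_delta.
by rewrite mxE !eqxx expr1n.
Qed.

Lemma sum_dotv u (I : Type) (r : seq I) (F : I -> 'rV[R]_n) :
  dotv u (\sum_(i <- r) F i) = \sum_(i <- r) dotv u (F i).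
Proof.
elim/big_rec2 : _ => [|i x y _ <-]; last exact: dotvDr.
by rewrite -(subrr u) dotvBr subrr.
Qed.

Lemma dotv_oproj_delta V i k :
  dotv (oproj V (delta_mx 0 i)) (oproj V (delta_mx 0 k)) = oproj V (delta_mx 0 k) 0 i.
Proof. by rewrite oproj_dotv ?oproj_mem// dotvC dotv_delta. Qed.

Lemma oproj_delta_sym V i k :
  oproj V (delta_mx 0 i) 0 k = oproj V (delta_mx 0 k) 0 i.
Proof. by rewrite -dotv_oproj_delta dotvC dotv_oproj_delta. Qed.

(** The hypothesis says that [u] is its own projection, because the matrix of an
    orthogonal projection is symmetric. *)
Lemma mem_vspace_oproj V u :
  (forall i, u 0 i = dotv u (oproj V (delta_mx 0 i))) -> u \in V.
Proof.
move=> uP; suff -> : u = \sum_i u 0 i *: oproj V (delta_mx 0 i).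
  by apply: memv_suml => i _; apply: memvZ; exact: oproj_mem.
apply/rowP => k; rewrite summxE uP dotvE; apply: eq_bigr => i _.
by rewrite mxE oproj_delta_sym.
Qed.

Lemma vspace_le_oproj V W :
  (forall i, oproj V (delta_mx 0 i) \in W) -> (V <= W)%VS.
Proof.
move=> VW; apply/subvP => v vV.
suff -> : v = \sum_i v 0 i *: oproj V (delta_mx 0 i).
  by apply: memv_suml => i _; exact: memvZ.
apply/eqP; rewrite -subr_eq0; set d := v - _.
have dV : d \in V.
  by rewrite rpredB// memv_suml// => i _; apply: memvZ; exact: oproj_mem.
apply/eqP/dotv_eq0; rewrite {2}/d dotvBr sum_dotv [X in X - _]dotvE.
apply/eqP; rewrite subr_eq0; apply/eqP/eq_bigr => i _.
by rewrite dotvZr (dotvC d) oproj_dotv// dotvC dotv_delta mulrC.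
Qed.

Lemma unit_ball0 V : unit_ball V 0.
Proof. by split; [exact: mem0v|rewrite enorm0]. Qed.

Lemma hausdorff_dist_approx V W r v :
  hausdorff_dist (unit_ball V) (unit_ball W) < r -> unit_ball V v ->
  exists2 w, unit_ball W w & enorm (v - w) < r.
Proof.
move=> VWr Vv.
have lb w (B : set 'rV[R]_n) : has_lbound [set enorm (w - a) | a in B].
  by exists 0 => _ [a _ <-]; exact: enorm_ge0.
have : edist_to (unit_ball W) v < r.
  apply: le_lt_trans VWr; rewrite /hausdorff_dist le_max; apply/orP; left.
  apply: ub_le_sup; last by exists v.
  exists 1 => _ [a [_ a1] <-]; apply: le_trans a1.
  by apply: ge_inf => //; exists 0; [exact: unit_ball0|rewrite subr0].
move=> h; have ne : [set enorm (v - a) | a in unit_ball W] !=set0.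
  by exists (enorm (v - 0)); exists 0 => //; exact: unit_ball0.
by have [_ [w Ww <-] vw] := inf_lt ne h; exists w.
Qed.

Lemma hausdorff_dist_sym (A B : set 'rV[R]_n) : hausdorff_dist A B = hausdorff_dist B A.
Proof. by rewrite /hausdorff_dist maxC. Qed.

(** Write p and q for the two projections of [e].  As p is orthogonal to e - p and q to
    e - q, the left-hand side equals p . (e - q) + q . (e - p).  Replacing p by a
    point of [W] at distance less than [r] kills the first product, so it is at most
    r; likewise for the second. *)
Lemma oproj_hausdorff_le V W r e : enorm e <= 1 ->
  hausdorff_dist (unit_ball V) (unit_ball W) < r ->
  enorm (oproj V e - oproj W e) ^+ 2 <= 2 * r.
Proof.
move=> e1 VWr; set p := oproj V e; set q := oproj W e.
have key U U' : hausdorff_dist (unit_ball U) (unit_ball U') < r ->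
    dotv (oproj U e) (e - oproj U' e) <= r.
  move=> h; have Up : unit_ball U (oproj U e).
    by split; [exact: oproj_mem|exact: le_trans (enorm_oproj_le _ _) e1].
  have [w [wU' _] pw] := hausdorff_dist_approx h Up.
  have w0 : dotv w (e - oproj U' e) = 0.
    by rewrite dotvC; case: (oprojP U' e) => _; exact.
  have -> : dotv (oproj U e) (e - oproj U' e) = dotv (oproj U e - w) (e - oproj U' e).
    by rewrite dotvBl w0 subr0.
  apply: le_trans (dotv_le _ _) _.
  have : enorm (e - oproj U' e) <= 1.
    exact: le_trans (enorm_oproj_compl_le _ _) e1.
  have := enorm_ge0 (oproj U e - w).
  have := enorm_ge0 (e - oproj U' e).
  nra.
have k1 := key _ _ VWr; rewrite hausdorff_dist_sym in VWr; have k2 := key _ _ VWr.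
have p0 : dotv p (e - p) = 0 by rewrite dotvC; case: (oprojP V e) => + ; auto.
have q0 : dotv q (e - q) = 0 by rewrite dotvC; case: (oprojP W e) => + ; auto.
rewrite enorm_sqr.
have -> : dotv (p - q) (p - q) = dotv p (e - q) + dotv q (e - p) - dotv p (e - p) - dotv q (e - q).
  by rewrite !dotvBl !dotvBr; ring.
rewrite p0 q0 -/p -/q in k1 k2 *; lra.
Qed.

End projection.

(** * Sections of the tangent distribution *)

Section ae_countable.
Context d {T : measurableType d} {R : realType} (mu : {measure set T -> \bar R}).

Lemma ae_forall_countable (I : countType) (P : I -> set T) :
  (forall k, {ae mu, forall x, P k x}) -> {ae mu, forall x, forall k, P k x}.
Proof.
move=> aeP.
apply: (@negligibleS _ _ _ mu (\bigcup_k
    (if unpickle k is Some i then ~` P i else set0))).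
  by move=> x /= /existsNP[i Pi]; exists (pickle i) => //; rewrite pickleK.
apply: negligible_bigcup => k; case: unpickle => [i|]; first exact: aeP.
exact: negligible_set0.
Qed.

End ae_countable.

Section tangent_sections.
Context {R : realType} {n : nat}.
Implicit Types (V W : {vspace 'rV[R]_n}) (e u v w : 'rV[R]_n).

(** The projection is continuous in the subspace, so the preimage of an open set is
    open in the Grassmannian. *)
Lemma measurable_oproj (T : Gr_distribution R n) e : enorm e <= 1 ->
  measurable_fun setT (fun x => oproj (T x) e).
Proof.
move=> e1; apply: (@measurability _ _ _ _ _ _ (@open 'rV[R]_n)) => // _ [B oB <-].
rewrite setTI; pose O := [set V | B (oproj V e)].
apply: (@distribution_borel _ _ T O); apply: sub_sigma_algebra => V BV.
have [r /= r0 rB] : nbhs_ball (oproj V e) B.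
  by rewrite nbhs_ballE; exact: open_nbhs_nbhs.
(* The squared distance of the projections is then at most r^2 / 2. *)
exists (r ^+ 2 / 2 / 2); first by rewrite !divr_gt0// exprn_gt0.
move=> W /(oproj_hausdorff_le e1) h; apply: rB; rewrite -ball_normE /=.
apply: le_lt_trans (norm_le_enorm _) _.
rewrite -(@ltr_sqr _ _ r) ?nnegrE ?enorm_ge0 ?(ltW r0)//.
apply: le_lt_trans h _; have : 0 < r ^+ 2 by rewrite exprn_gt0.
lra.
Qed.

Variable mu : {measure set 'rV[R]_n -> \bar R}.
Hypothesis mu_radon : radon mu.

(** Sections with bounded support: they are square integrable because balls have
    finite measure, and for N large they span T(x). *)
Definition local_section (T : Gr_distribution R n) (N : nat) (i : 'I_n) :
    'rV[R]_n -> 'rV[R]_n :=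
  fun x => if sqnorm x <= N%:R then oproj (T x) (delta_mx 0 i) else 0.

Lemma Gamma_local_section T N i : @Gamma _ _ mu T (local_section T N i).
Proof.
have mB : measurable [set x : 'rV[R]_n | sqnorm x <= N%:R].
  exact: measurable_sqnorm_le.
have ms : measurable_fun setT (local_section T N i).
  apply: measurable_fun_ifT => //.
  - apply: (@measurable_fun_bool _ _ _ _ true); rewrite setTI.
    exact: mB.
  - by apply: measurable_oproj; rewrite enorm_delta.
split; last first.
  apply: aeW => x; rewrite /local_section; case: ifP => _; first exact: oproj_mem.
  exact: mem0v.
split=> //; apply: (@bounded_Lfun2 _ _ _ _ _ 1 [set x | sqnorm x <= N%:R]) => //.
- by apply: measurableT_comp; [exact: measurable_enorm|exact: ms].
- exact: (mu_radon (@compact_sqnorm_le R n _)).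
- move=> x; rewrite ger0_norm ?enorm_ge0// /local_section /=; case: ifP => _.
    by apply: le_trans (enorm_oproj_le _ _) _; rewrite enorm_delta.
  by rewrite enorm0.
- by move=> x /negP xN; rewrite /= /local_section (negbTE xN) enorm0.
Qed.

(** Local sections are of the form [iota u], and they span [T]. *)
Lemma tangent_le (M : premodule 'rV[R]_n) (iota : nm_dual mu M -> L2fields mu 1 n)
    (T V : Gr_distribution R n) :
  is_tangent_distribution iota T ->
  (forall u : nm_dual mu M, nm_elt u -> {ae mu, forall x, iota u x \in V x}) ->
  {ae mu, forall x, (T x <= V x)%VS}.
Proof.
move=> Ttan iotaV.
have : {ae mu, forall x, forall N, forall i, local_section T N i x \in V x}.
  apply: ae_forall_countable => N; apply: filter_forall => i.
  have sG := Gamma_local_section T N i.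
  have [u uelt us] := (Ttan _ sG.1).1 sG.
  by move: (iotaV _ uelt) us; apply: filterS2 => x uV <-.
apply: filterS => x sV; apply: vspace_le_oproj => i.
have := sV (Num.bound (sqnorm x)) i.
rewrite /local_section ifT// ltW// archi_boundP//.
by apply: sumr_ge0 => k _; exact: sqr_ge0.
Qed.

End tangent_sections.

(** * Combinations in normed modules *)

Section normed_module.
Context {R : realType} d (T : measurableType d) (mu : {measure set T -> \bar R}).
Variables (M : premodule T) (hM : is_normed_module mu M).
Implicit Types (u v w : M) (a b : T -> R).

Lemma nm_eltN v : nm_elt v -> nm_elt (- v).
Proof. by move=> ev; rewrite -sub0r; apply: nm_eltB hM _ _ (nm_elt0 hM) ev. Qed.

Lemma nm_eltD v w : nm_elt v -> nm_elt w -> nm_elt (v + w).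
Proof.
by move=> ev ew; rewrite -[w]opprK; apply: (nm_eltB hM) => //; exact: nm_eltN.
Qed.

Lemma nm_elt_sum (I : Type) (r : seq I) (F : I -> M) : (forall i, nm_elt (F i)) ->
  nm_elt (\sum_(i <- r) F i).
Proof.
by move=> eF; elim/big_rec : _ => [|i x _ ex]; [exact: (nm_elt0 hM)|exact: nm_eltD].
Qed.

Lemma nm_eqN v w : nm_elt v -> nm_elt w -> nm_eq v w -> nm_eq (- v) (- w).
Proof.
move=> ev ew vw; rewrite -(sub0r v) -(sub0r w).
apply: (nm_eqB hM) => //; [exact: (nm_elt0 hM)..|].
exact: (nm_eq_refl hM (nm_elt0 hM)).
Qed.

Lemma nm_eqD v v' w w' : nm_elt v -> nm_elt v' -> nm_elt w -> nm_elt w' ->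
  nm_eq v v' -> nm_eq w w' -> nm_eq (v + w) (v' + w').
Proof.
move=> ev ev' ew ew' vv' ww'; rewrite -[w]opprK -[w']opprK.
by apply: (nm_eqB hM) => //; [exact: nm_eltN|exact: nm_eltN|exact: nm_eqN].
Qed.

Lemma nm_eq_sum (I : Type) (r : seq I) (F G : I -> M) :
  (forall i, nm_elt (F i)) -> (forall i, nm_elt (G i)) ->
  (forall i, nm_eq (F i) (G i)) -> nm_eq (\sum_(i <- r) F i) (\sum_(i <- r) G i).
Proof.
move=> eF eG FG; elim: r => [|i r IH].
  by rewrite !big_nil; exact: (nm_eq_refl hM (nm_elt0 hM)).
by rewrite !big_cons; apply: nm_eqD => //; exact: nm_elt_sum.
Qed.

Lemma nm_eq_add_self v : nm_elt v -> nm_eq v (v + v) -> nm_eq v 0.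
Proof.
move=> ev vv; apply: (nm_eq_sym hM) => //; first exact: (nm_elt0 hM).
have := nm_eqB hM ev (nm_eltD ev ev) ev ev vv (nm_eq_refl hM ev).
by rewrite subrr addrK.
Qed.

Lemma nm_norm0 : {ae mu, forall x, nm_norm (0 : M) x = 0}.
Proof.
have h := (nm_norm_eq0 hM (nm_elt0 hM)).2 (nm_eq_refl hM (nm_elt0 hM)).
by move: h; apply: filterS => x; exact.
Qed.

Lemma nm_norm_eqP v w : nm_elt v -> nm_elt w -> nm_eq v w ->
  {ae mu, forall x, nm_norm v x = nm_norm w x}.
Proof.
by move=> ev ew /(nm_norm_eq hM ev ew); apply: filterS => x; exact.
Qed.

Lemma nm_norm_sum (I : Type) (r : seq I) (F : I -> M) : (forall i, nm_elt (F i)) ->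
  {ae mu, forall x, nm_norm (\sum_(i <- r) F i) x <= \sum_(i <- r) nm_norm (F i) x}.
Proof.
move=> eF; elim: r => [|i r IH].
  by move: nm_norm0; apply: filterS => x; rewrite !big_nil => ->.
have := nm_normD hM (eF i) (nm_elt_sum r eF).
move: IH; apply: filterS2 => x h1 h2; rewrite !big_cons.
by apply: le_trans h2 _; rewrite lerD2l.
Qed.

(** Two combinations of the same elements, with coefficients in L^oo, are compared by
    the triangle inequality; with [b] constant this is what transfers estimates
    from linear combinations over the reals to combinations over L^oo. *)
Lemma nm_norm_comb_le k (m : 'I_k -> M) (a b : 'I_k -> T -> R) :
  (forall i, nm_elt (m i)) ->
  (forall i, a i \in Lfun mu +oo%E) -> (forall i, b i \in Lfun mu +oo%E) ->
  (forall i, a i \- b i \in Lfun mu +oo%E) ->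
  {ae mu, forall x, nm_norm (\sum_i nm_act (a i) (m i)) x <=
    nm_norm (\sum_i nm_act (b i) (m i)) x + \sum_i `|a i x - b i x| * nm_norm (m i) x}.
Proof.
move=> em ea eb eab.
have ecomb (c : 'I_k -> T -> R) : (forall i, c i \in Lfun mu +oo%E) ->
    nm_elt (\sum_i nm_act (c i) (m i)).
  by move=> ec; apply: nm_elt_sum => i; exact: (nm_elt_act hM).
have E : nm_eq (\sum_i nm_act (a i) (m i))
    (\sum_i nm_act (b i) (m i) + \sum_i nm_act (a i \- b i) (m i)).
  rewrite -big_split /=; apply: nm_eq_sum => i.
  - exact: (nm_elt_act hM).
  - by apply: nm_eltD; exact: (nm_elt_act hM).
  have {1}-> : a i = b i \+ (a i \- b i) by apply/funext => x /=; rewrite addrC subrK.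
  exact: (nm_actDl hM).
have n1 := nm_norm_eqP (ecomb _ ea) (nm_eltD (ecomb _ eb) (ecomb _ eab)) E.
have n2 := nm_normD hM (ecomb _ eb) (ecomb _ eab).
have n3 := nm_norm_sum (index_enum 'I_k) (fun i => nm_elt_act hM (eab i) (em i)).
have n4 : {ae mu, forall x, forall i, nm_norm (nm_act (a i \- b i) (m i)) x =
    `|a i x - b i x| * nm_norm (m i) x}.
  apply: filter_forall => i.
  by have := nm_norm_act hM (eab i) (em i); apply: filterS => x; exact.
move: n3 n4; apply: filterS3 (filterI n1 n2) => x [-> h2] h3 h4.
apply: le_trans h2 _; rewrite lerD2l; apply: le_trans h3 _.
by apply: ler_sum => i _; rewrite h4.
Qed.

(** An estimate of the norm of the combinations with constant coefficients implies the
    same estimate, here with bound 0, for coefficients in L^oo: off one null set the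
    estimate holds for all rational coefficients simultaneously, and rational
    numbers approximate the values [a i x]. *)
Lemma nm_comb_eq0 k p q (m : 'I_k -> M) (a : 'I_k -> T -> R) (N : 'I_k -> T -> 'M[R]_(p, q)) :
  (forall i, nm_elt (m i)) ->
  (forall i, a i \in Lfun mu +oo%E) ->
  (forall i (r : R), cst r \in Lfun mu +oo%E /\ a i \- cst r \in Lfun mu +oo%E) ->
  (forall c : 'I_k -> R, {ae mu, forall x,
     nm_norm (\sum_i nm_act (cst (c i)) (m i)) x <= enorm (\sum_i c i *: N i x)}) ->
  {ae mu, forall x, \sum_i a i x *: N i x = 0} ->
  nm_eq (\sum_i nm_act (a i) (m i)) 0.
Proof.
move=> em ea ear hN aN0.
have esum : nm_elt (\sum_i nm_act (a i) (m i)).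
  by apply: nm_elt_sum => i; exact: (nm_elt_act hM).
apply/(nm_norm_eq0 hM esum).
have main : {ae mu, forall x, forall c : {ffun 'I_k -> rat},
    nm_norm (\sum_i nm_act (a i) (m i)) x <=
    enorm (\sum_i ratr (c i) *: N i x) + \sum_i `|a i x - ratr (c i)| * nm_norm (m i) x}.
  apply: ae_forall_countable => c.
  have := @nm_norm_comb_le k m a (fun i => cst (ratr (c i))) em ea
    (fun i => (ear i _).1) (fun i => (ear i _).2).
  move: (hN (fun i => ratr (c i))); apply: filterS2 => x h1 h2.
  by apply: le_trans h2 _; rewrite lerD2r.
have nonneg := nm_norm_ge0 hM esum.
have nonnegm : {ae mu, forall x, forall i, 0 <= nm_norm (m i) x}.
  by apply: filter_forall => i; exact: (nm_norm_ge0 hM).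
move: nonneg main; apply: filterS3 (filterI aN0 nonnegm) => x [h0 m0] n0 h _.
apply/eqP; rewrite eq_le n0 andbT; apply/ler_addgt0Pr => e e0; rewrite add0r.
(* Coefficients within e / K give the bound e; the summand 1 makes K positive. *)
pose K := \sum_i (enorm (N i x) + nm_norm (m i) x) + 1.
have K0 : 0 < K by rewrite ltr_wpDl// sumr_ge0// => i _; rewrite addr_ge0 ?enorm_ge0.
have eK : 0 < e / K by rewrite divr_gt0.
have /choice[c hc] : forall i, exists s : rat, `|a i x - ratr s| <= e / K.
  move=> i; have /rat_in_itvoo[s] : a i x - e / K < a i x + e / K by lra.
  rewrite in_itv/= => /andP[q1 q2]; exists s.
  by rewrite ler_norml; apply/andP; split; lra.
apply: le_trans (h [ffun i => c i]) _.
have E : \sum_i ratr ([ffun i => c i] i) *: N i x =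
    \sum_i (ratr (c i) - a i x) *: N i x + \sum_i a i x *: N i x.
  by rewrite -big_split /=; apply: eq_bigr => i _; rewrite ffunE -scalerDl subrK.
rewrite E h0 addr0.
apply: (@le_trans _ _ (\sum_i (e / K) * (enorm (N i x) + nm_norm (m i) x))).
  apply: (@le_trans _ _ (\sum_i `|a i x - ratr (c i)| * (enorm (N i x) + nm_norm (m i) x))).
    under [leRHS]eq_bigr do rewrite mulrDr.
    rewrite big_split /=; apply: lerD; last first.
      by apply: ler_sum => i _; rewrite ffunE.
    apply: le_trans (enorm_sum _ _ _) _; apply: ler_sum => i _.
    by rewrite enormZ distrC.
  by apply: ler_sum => i _; apply: ler_wpM2r => //; rewrite addr_ge0 ?enorm_ge0.
rewrite -mulr_sumr mulrAC ler_pdivrMr// ler_pM2l//.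
by rewrite lerDl.
Qed.

End normed_module.

(** * The tangent module and the Alberti--Marchese distribution *)

Section dual.
Context {R : realType} d (T : measurableType d) (mu : {measure set T -> \bar R}).
Variables (M : premodule T) (hM : is_normed_module mu M).

Lemma dual_comb (L : nm_dual mu M) (J : Type) (r : seq J) (a : J -> T -> R) (m : J -> M) :
  nm_elt L -> (forall i, nm_elt (m i)) -> (forall i, a i \in Lfun mu +oo%E) ->
  {ae mu, forall x, L (\sum_(i <- r) nm_act (a i) (m i)) x =
    \sum_(i <- r) a i x * L (m i) x}.
Proof.
case=> _ Leq Llin _ em ea.
have e0 := nm_elt0 hM.
have c1 : cst 1 \in Lfun mu +oo%E.
  by apply: (@bounded_Lfun_oo _ _ _ _ _ 1) => // x; rewrite normr1.
have L0 : {ae mu, forall x, L (0 : M) x = 0}.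
  have h1 := Llin (cst 1) 0 0 c1 e0 e0.
  have e1 := nm_elt_act hM c1 e0.
  have h2 : nm_eq (nm_act (cst 1) (0 : M) + 0) 0.
    by rewrite addr0; exact: (nm_act1 hM e0).
  have h3 := Leq _ _ (nm_eltD hM e1 e0) e0 h2.
  move: h1 h3; apply: filterS2 => x /(_ I) h1 /(_ I) h3.
  by move: h1; rewrite h3 /= mul1r => /eqP; rewrite -subr_eq subrr eq_sym => /eqP.
elim: r => [|i r IH]; first by move: L0; apply: filterS => x; rewrite !big_nil.
have h1 := Llin _ _ _ (ea i) (em i)
  (nm_elt_sum hM r (fun j => nm_elt_act hM (ea j) (em j))).
by move: IH h1; apply: filterS2 => x IH /(_ I) h1; rewrite !big_cons h1 /= IH.
Qed.

End dual.

Section cotangent.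
Context {R : realType} {n : nat} (mu : {measure set 'rV[R]_n -> \bar R}).
Hypothesis mu_radon : radon mu.
Variables (M : @premodule R _ 'rV[R]_n) (d_mu : ('rV[R]_n -> R) -> M).
Hypothesis M_cotangent : is_cotangent_module mu d_mu.
Variable V : Gr_distribution R n.
Hypothesis V_AM : is_AM_distribution mu V.

Let hM := cotangent_normed_module M_cotangent.

Variable c : R.
Implicit Types p : 'rV[R]_n -> R.
Notation cutoff := (fun x : 'rV[R]_n => flat 0 (c - sqnorm x)).
Notation cut p := (p \* cutoff).

Lemma cut_derivable p x v : bump_algebra c p -> derivable (cut p) x v.
Proof.
move=> bp; apply: diff_derivable.
by case: (bump_algebra_differentiable (bump_mul bp (bump_flat c 0))).
Qed.

(** The Alberti--Marchese gradient of a smooth function is determined by its directional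
    derivatives along [V x], because it belongs to [V x]. *)
Lemma cut_nabla p : bump_algebra c p -> exists nabla : 'rV[R]_n -> 'rV[R]_n,
  [/\ weak_upper_gradient mu (cut p) (enorm \o nabla) &
     {ae mu, forall x, nabla x \in V x /\
       forall v, v \in V x -> dotv (nabla x) v = 'D_v (cut p) x}].
Proof.
move=> bp; have [AM1 [f0 f0L f0V]] := V_AM.
have FL := cutoff_elipschitz bp; have [_ Fs] := cutoff_Cc_infty bp.
have [nabla [[mn nL2] nV] nabla_lim] := AM1 _ FL Fs.
exists nabla; split; first exact: (weak_upper_gradient_AM FL nL2 nabla_lim f0L f0V).
move: nV nabla_lim; apply: filterS2 => x nVx lim; split=> // v vV.
apply/esym/(is_derive_differential_along vV lim).
exact/derivableP/cut_derivable.
Qed.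

Lemma cut_W12 p : bump_algebra c p -> W12 mu (cut p).
Proof.
move=> bp; split; first exact: cutoff_L2.
by have [nabla [wug _]] := cut_nabla bp; exists (enorm \o nabla).
Qed.

Lemma d_mu_cst0 : nm_eq (d_mu (cst 0)) 0.
Proof.
have W0 : W12 mu (cst 0).
  have := cut_W12 (bump_cst c 0); congr (W12 mu _).
  by apply/funext => x; rewrite /= mul0r.
have e0 := cotangent_elt M_cotangent W0.
have c1 : cst 1 \in Lfun mu +oo%E.
  by apply: (@bounded_Lfun_oo _ _ _ _ _ 1) => // x; rewrite normr1.
have e1 := nm_elt_act hM c1 e0.
apply: (nm_eq_add_self hM) => //.
have := cotangent_linear M_cotangent 1 W0 W0.
rewrite (_ : (fun x => _) = cst 0); last by apply/funext => x; rewrite /= mulr0 addr0.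
move=> h; apply: (nm_eq_trans hM e0 (nm_eltD hM e1 e0) (nm_eltD hM e0 e0) h).
exact: (nm_eqD hM e1 e0 e0 e0 (nm_act1 hM e0) (nm_eq_refl hM e0)).
Qed.

Lemma bump_lin (I : Type) (r : seq I) (a : I -> R) (p : I -> 'rV[R]_n -> R) :
  (forall i, bump_algebra c (p i)) -> bump_algebra c (fun x => \sum_(i <- r) a i * p i x).
Proof.
move=> bp; elim: r => [|i r IH].
  rewrite (_ : (fun x => _) = cst 0); first exact: bump_cst.
  by apply/funext => x; rewrite big_nil.
rewrite (_ : (fun x => _) = cst (a i) \* p i \+ (fun x => \sum_(i <- r) a i * p i x)).
  by apply: bump_add => //; apply: bump_mul => //; exact: bump_cst.
by apply/funext => x; rewrite big_cons.
Qed.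

Lemma cst_Loo (r : R) : cst r \in Lfun mu +oo%E.
Proof. by apply: (@bounded_Lfun_oo _ _ _ _ _ `|r|) => //; exact: measurable_cst. Qed.

Lemma d_mu_lin (I : Type) (r : seq I) (a : I -> R) (p : I -> 'rV[R]_n -> R) :
  (forall i, bump_algebra c (p i)) ->
  nm_eq (d_mu (cut (fun x => \sum_(i <- r) a i * p i x)))
    (\sum_(i <- r) nm_act (cst (a i)) (d_mu (cut (p i)))).
Proof.
move=> bp; elim: r => [|i r IH].
  rewrite big_nil (_ : cut _ = cst 0); first exact: d_mu_cst0.
  by apply/funext => x; rewrite /= big_nil mul0r.
have Wi j := cut_W12 (bp j).
have Wr := cut_W12 (bump_lin r a bp).
have ei j := cotangent_elt M_cotangent (Wi j).
have ea j := nm_elt_act hM (cst_Loo (a j)) (ei j).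
have er := cotangent_elt M_cotangent Wr.
have Wir := cut_W12 (bump_lin (i :: r) a bp).
have esum : nm_elt (\sum_(j <- r) nm_act (cst (a j)) (d_mu (cut (p j)))).
  exact: (nm_elt_sum hM).
have h := cotangent_linear M_cotangent (a i) (Wi i) Wr.
have E : (fun x => a i * cut (p i) x + cut (fun x => \sum_(j <- r) a j * p j x) x) =
    cut (fun x => \sum_(j <- i :: r) a j * p j x).
  by apply/funext => x; rewrite /= big_cons mulrDl mulrA.
rewrite E in h; rewrite big_cons.
have eir := cotangent_elt M_cotangent Wir.
apply: (nm_eq_trans hM eir (nm_eltD hM (ea i) er) (nm_eltD hM (ea i) esum) h).
exact: (nm_eqD hM (ea i) (ea i) er esum (nm_eq_refl hM (ea i)) IH).
Qed.

Lemma derive_cut_lin (k : nat) (a : 'I_k -> R) (p : 'I_k -> 'rV[R]_n -> R) x v :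
  (forall i, bump_algebra c (p i)) ->
  'D_v (cut (fun x => \sum_i a i * p i x)) x = \sum_i a i * 'D_v (cut (p i)) x.
Proof.
move=> bp; have E : cut (fun x => \sum_i a i * p i x) = \sum_i (a i \*: cut (p i)).
  rewrite fct_sumE; apply/funext => y; rewrite /= mulr_suml.
  by apply: eq_bigr => i _; rewrite /= /GRing.scale/= mulrA.
have h i : is_derive x v (a i \*: cut (p i)) (a i *: 'D_v (cut (p i)) x).
  exact/is_deriveZ/derivableP/cut_derivable.
by rewrite E (@derive_val _ _ _ _ _ _ _ (is_derive_sum h)).
Qed.

(** A vector of [V x] is determined by its products with [V x], so the gradient along
    [V] is linear in the function, and minimality of |d_mu f| applies to the
    combination of the functions. *)
Lemma nm_norm_d_mu_le (k : nat) (p : 'I_k -> 'rV[R]_n -> R)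
    (nabla : 'I_k -> 'rV[R]_n -> 'rV[R]_n) (a : 'I_k -> R) :
  (forall i, bump_algebra c (p i)) ->
  (forall i, {ae mu, forall x, nabla i x \in V x /\
     forall v, v \in V x -> dotv (nabla i x) v = 'D_v (cut (p i)) x}) ->
  {ae mu, forall x, nm_norm (\sum_i nm_act (cst (a i)) (d_mu (cut (p i)))) x <=
    enorm (\sum_i a i *: nabla i x)}.
Proof.
move=> bp np; have bc := bump_lin (index_enum 'I_k) a bp.
have [nab [wug nabP]] := cut_nabla bc.
have [_ dmin] := cotangent_norm M_cotangent (cut_W12 bc).
have e1 := cotangent_elt M_cotangent (cut_W12 bc).
have e2 : nm_elt (\sum_i nm_act (cst (a i)) (d_mu (cut (p i)))).
  apply: (nm_elt_sum hM) => i; apply: (nm_elt_act hM); first exact: cst_Loo.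
  exact: (cotangent_elt M_cotangent (cut_W12 (bp i))).
have n12 := nm_norm_eqP hM e1 e2 (d_mu_lin _ a bp).
have {}np : {ae mu, forall x, forall i, nabla i x \in V x /\
     forall v, v \in V x -> dotv (nabla i x) v = 'D_v (cut (p i)) x}.
  exact: filter_forall.
move: nabP (dmin _ wug); apply: filterS3 (filterI n12 np) => x [<- {}np] [nabV nabD].
move=> /= h; apply: le_trans h _; rewrite le_eqVlt; apply/orP; left; apply/eqP.
congr enorm; apply/eqP; rewrite -subr_eq0; apply/eqP/dotv_eq0.
set z := _ - _; have zV : z \in V x.
  rewrite rpredB// memv_suml// => i _; apply: memvZ; exact: (np i).1.
rewrite {1}/z dotvBl nabD// derive_cut_lin// dotvC sum_dotv.
apply/eqP; rewrite subr_eq0; apply/eqP/eq_bigr => i _.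
by rewrite dotvZr dotvC (np i).2.
Qed.

End cotangent.

Section adjoint.
Context {R : realType} {n : nat} (mu : {measure set 'rV[R]_n -> \bar R}).
Hypothesis mu_radon : radon mu.
Variables (M : @premodule R _ 'rV[R]_n) (d_mu : ('rV[R]_n -> R) -> M).
Hypothesis M_cotangent : is_cotangent_module mu d_mu.
Variables (P : L2fields mu n 1 -> M) (hP : is_cotangent_projection d_mu P).
Variables (iota : nm_dual mu M -> L2fields mu 1 n) (hiota : is_adjoint P iota).
Variable V : Gr_distribution R n.
Hypothesis V_AM : is_AM_distribution mu V.

Let hM := cotangent_normed_module M_cotangent.

Section cutoff.
Variable c : R.
Implicit Types p : 'rV[R]_n -> R.
Notation cutoff := (fun x : 'rV[R]_n => flat 0 (c - sqnorm x)).
Notation cut p := (p \* cutoff).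

(** By adjointness, since the differential of a function pairs with a vector to the
    directional derivative. *)
Lemma dual_d_mu (u : nm_dual mu M) p : nm_elt u -> bump_algebra c p ->
  {ae mu, forall x, u (d_mu (cut p)) x = 'D_(iota u x) (cut p) x}.
Proof.
move=> eu bp; have [[Pelt _ _ _] Pd] := hP; have [_ adj] := hiota.
have ed := cutoff_differential_elt mu_radon bp.
have ePd := Pelt _ ed.
have edm := cotangent_elt M_cotangent (cut_W12 mu_radon V_AM bp).
have [_ ueq _ _] := eu.
have h1 := ueq _ _ ePd edm (Pd _ (cutoff_Cc_infty bp)).
have h2 := adj _ _ ed eu.
move: h1 h2; apply: filterS2 => x /(_ I) <- /(_ I) ->.
rewrite derive_pairing//.
by case: (bump_algebra_differentiable (bump_mul bp (bump_flat c 0))).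
Qed.

(** Multiplied by the cutoff beta, these functions are beta itself and the x_k beta,
    whose differentials span the cotangent space wherever beta is positive. *)
Definition gen (j : 'I_n.+1) : 'rV[R]_n -> R :=
  if unlift ord0 j is Some i then fun x => x 0 i else cst 1.

Lemma bump_gen j : bump_algebra c (gen j).
Proof.
rewrite /gen; case: unliftP => [i _|_]; [exact: bump_coord|exact: bump_cst].
Qed.

(** The component of the i-th basis vector orthogonal to [V x]: a covector that
    annihilates [V x]. *)
Definition perp (i : 'I_n) (x : 'rV[R]_n) : 'rV[R]_n :=
  delta_mx 0 i - oproj (V x) (delta_mx 0 i).

(** Coefficients of beta * [perp i] in terms of the differentials of the generators,
    read off from beta dx_k = d(x_k beta) - x_k d beta; truncated to a ball to be
    bounded. *)
Definition coef (i : 'I_n) (j : 'I_n.+1) (x : 'rV[R]_n) : R :=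
  if sqnorm x <= c then
    if unlift ord0 j is Some k then perp i x 0 k else - \sum_k perp i x 0 k * x 0 k
  else 0.

Lemma sum_coef i x v : \sum_j coef i j x * 'D_v (cut (gen j)) x =
  if sqnorm x <= c then cutoff x * dotv (perp i x) v else 0.
Proof.
case: ifPn => xc; last first.
  by rewrite big1// => j _; rewrite /coef (negbTE xc) mul0r.
have dc : derivable cutoff x v by exact/diff_derivable/flat_sqnorm_differentiable.
rewrite big_ord_recl /coef xc unlift_none /gen unlift_none.
rewrite (_ : cst 1 \* cutoff = cutoff); last by apply/funext => y; rewrite /= mul1r.
rewrite dotvE mulr_sumr mulNr mulr_suml -sumrN -big_split /=.
apply: eq_bigr => k _; rewrite liftK.
have -> : 'D_v ((fun y : 'rV[R]_n => y 0 k) \* cutoff) x =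
    x 0 k * 'D_v cutoff x + cutoff x * v 0 k.
  rewrite deriveM//; last by have [] := is_derive_coord k x v.
  by rewrite (@derive_val _ _ _ _ _ _ _ (is_derive_coord k x v)).
by ring.
Qed.

Lemma measurable_perp_coord i k : measurable_fun setT (fun x => perp i x 0 k).
Proof.
rewrite (_ : (fun x => _) = cst ((delta_mx 0 i : 'rV[R]_n) 0 k) \-
    (fun x => oproj (V x) (delta_mx 0 i) 0 k)); last first.
  by apply/funext => x; rewrite /perp !mxE.
apply: measurable_funB; first exact: measurable_cst.
apply: (@measurableT_comp _ _ _ _ _ _ (fun A : 'rV[R]_n => A 0 k)).
  exact: measurable_coord.
by apply: measurable_oproj; rewrite enorm_delta.
Qed.

Lemma coef_measurable i j : measurable_fun setT (coef i j).
Proof.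
apply: measurable_fun_ifT.
- apply: (@measurable_fun_bool _ _ _ _ true); rewrite setTI.
  exact: measurable_sqnorm_le.
- case: unliftP => [k _|_]; first exact: measurable_perp_coord.
  apply: measurable_funN.
  apply: measurable_sum => k; apply: measurable_funM; first exact: measurable_perp_coord.
  exact: measurable_coord.
- exact: measurable_cst.
Qed.

Lemma perp_coord_le i x k : `|perp i x 0 k| <= 1.
Proof.
apply: le_trans (coord_le_enorm _ _ _) _; apply: le_trans (enorm_oproj_compl_le _ _) _.
by rewrite enorm_delta.
Qed.

Lemma coef_bounded i j x : `|coef i j x| <= 1 + n%:R * (`|c| + 1).
Proof.
have nc : 0 <= n%:R * (`|c| + 1) by rewrite mulr_ge0// addr_ge0.
rewrite /coef; case: ifPn => xc; last by rewrite normr0 addr_ge0.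
case: unliftP => [k _|_].
  by apply: le_trans (perp_coord_le _ _ _) _; rewrite lerDl.
rewrite normrN; apply: (@le_trans _ _ (n%:R * (`|c| + 1))); last by rewrite lerDr.
apply: le_trans (ler_norm_sum _ _ _) _.
apply: (@le_trans _ _ (\sum_(k < n) (`|c| + 1))); last first.
  by rewrite sumr_const card_ord mulr_natl.
apply: ler_sum => k _; rewrite normrM -[leRHS]mul1r.
apply: ler_pM => //; first exact: perp_coord_le.
rewrite -(@ler_sqr _ `|x 0 k|) ?nnegrE ?addr_ge0// real_normK ?num_real//.
have : x 0 k ^+ 2 <= c.
  apply: le_trans xc; rewrite /sqnorm (bigD1 k)//= lerDl sumr_ge0// => l _.
  exact: sqr_ge0.
have := ler_norm c; have := normr_ge0 c; nra.
Qed.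

Lemma coef_Loo i j : coef i j \in Lfun mu +oo%E.
Proof. exact: bounded_Lfun_oo (coef_measurable i j) (coef_bounded i j). Qed.

Lemma coefB_Loo i j r : coef i j \- cst r \in Lfun mu +oo%E.
Proof.
apply: (@bounded_Lfun_oo _ _ _ _ _ (1 + n%:R * (`|c| + 1) + `|r|)).
  by apply: measurable_funB; [exact: coef_measurable|exact: measurable_cst].
move=> x /=; apply: le_trans (ler_normB _ _) _; rewrite lerD2r.
exact: coef_bounded.
Qed.

(** The field [perp i] annihilates [V], so the corresponding combination of gradients
    along [V] is orthogonal to [V] while lying in it. *)
Lemma coef_eq0 i : nm_eq (\sum_j nm_act (coef i j) (d_mu (cut (gen j)))) 0.
Proof.
have /choice[nabla nablaP] : forall j, exists nabla : 'rV[R]_n -> 'rV[R]_n,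
    {ae mu, forall x, nabla x \in V x /\
      forall v, v \in V x -> dotv (nabla x) v = 'D_v (cut (gen j)) x}.
  by move=> j; have [nabla [_ ?]] := cut_nabla V_AM (bump_gen j); exists nabla.
apply: (@nm_comb_eq0 _ _ _ _ _ hM _ _ _ _ _ nabla).
- by move=> j; exact: (cotangent_elt M_cotangent (cut_W12 mu_radon V_AM (bump_gen j))).
- exact: coef_Loo.
- by move=> j r; split; [exact: cst_Loo|exact: coefB_Loo].
- by move=> a; apply: (nm_norm_d_mu_le mu_radon M_cotangent V_AM a bump_gen nablaP).
have {}nablaP : {ae mu, forall x, forall j, nabla j x \in V x /\
    forall v, v \in V x -> dotv (nabla j x) v = 'D_v (cut (gen j)) x}.
  exact: filter_forall.
apply: filterS nablaP => x nP; apply: dotv_eq0; set z := \sum_j _.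
have zV : z \in V x by rewrite memv_suml// => j _; apply: memvZ; exact: (nP j).1.
rewrite {1}/z dotvC sum_dotv.
under eq_bigr => j _ do rewrite dotvZr dotvC (nP j).2//.
rewrite sum_coef; case: ifP => // _.
by have [_ h] := oprojP (V x) (delta_mx 0 i); rewrite h// mulr0.
Qed.

Lemma iota_dotv_perp (u : nm_dual mu M) i : nm_elt u ->
  {ae mu, forall x, sqnorm x < c -> dotv (perp i x) (iota u x) = 0}.
Proof.
move=> eu.
have em j := cotangent_elt M_cotangent (cut_W12 mu_radon V_AM (bump_gen j)).
have ecomb : nm_elt (\sum_j nm_act (coef i j) (d_mu (cut (gen j)))).
  by apply: (nm_elt_sum hM) => j; apply: (nm_elt_act hM); [exact: coef_Loo|exact: em].
have e0 := nm_elt0 hM.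
have [_ ueq _ _] := eu.
have h1 := ueq _ _ ecomb e0 (coef_eq0 i).
have h2 := dual_comb hM (index_enum 'I_n.+1) eu em (coef_Loo i).
have h0 : {ae mu, forall x, u (0 : M) x = 0}.
  have := dual_comb hM [::] eu em (coef_Loo i).
  by apply: filterS => x; rewrite !big_nil.
have h3 : {ae mu, forall x, forall j, u (d_mu (cut (gen j))) x =
    'D_(iota u x) (cut (gen j)) x}.
  by apply: filter_forall => j; exact: dual_d_mu (bump_gen j).
move: h0 h3; apply: filterS3 (filterI h1 h2) => x [h1x h2x] h0x h3x xc.
have := h1x I; rewrite h2x h0x.
under eq_bigr => j _ do rewrite h3x.
rewrite sum_coef (ltW xc) => /eqP; rewrite mulf_eq0 gt_eqF/=; first by move/eqP.
by rewrite flat_gt0// subr_gt0.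
Qed.

End cutoff.

(** Every point satisfies |x|^2 < N for some N, and there [iota u] is orthogonal to the
    vectors e_i - proj_V(e_i), hence equal to its projection on [V]. *)
Lemma iota_mem_AM (u : nm_dual mu M) : nm_elt u -> {ae mu, forall x, iota u x \in V x}.
Proof.
move=> eu.
have : {ae mu, forall x, forall N : nat, forall i, sqnorm x < N%:R ->
    dotv (perp i x) (iota u x) = 0}.
  apply: ae_forall_countable => N; apply: filter_forall => i.
  exact: iota_dotv_perp.
apply: filterS => x h; apply: mem_vspace_oproj => i.
have /= := h (Num.bound (sqnorm x)) i (archi_boundP _); rewrite /perp dotvBl.
rewrite (dotvC (delta_mx 0 i)) dotv_delta => /(_ _)/eqP; rewrite subr_eq0 dotvC => E.
by apply/eqP/E; apply: sumr_ge0 => k _; exact: sqr_ge0.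
Qed.

End adjoint.

Theorem corollary2p17 (R : realType) (n : nat)
  (mu : {measure set 'rV[R]_n -> \bar R}) (mu_radon : radon mu)
  (M : premodule 'rV[R]_n) (d_mu : ('rV[R]_n -> R) -> M)
  (M_cotangent : is_cotangent_module mu d_mu)
  (P_mu : L2fields mu n 1 -> M)
  (P_mu_projection : is_cotangent_projection d_mu P_mu)
  (iota_mu : nm_dual mu M -> L2fields mu 1 n)
  (iota_mu_adjoint : is_adjoint P_mu iota_mu)
  (T_mu : Gr_distribution R n) (T_mu_tangent : is_tangent_distribution iota_mu T_mu)
  (V_mu : Gr_distribution R n) (V_mu_AM : is_AM_distribution mu V_mu) :
  {ae mu, forall x, (T_mu x <= V_mu x)%VS}.
Proof.
apply: (tangent_le mu_radon T_mu_tangent) => u.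
exact: (iota_mem_AM mu_radon M_cotangent P_mu_projection iota_mu_adjoint V_mu_AM).
Qed.
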